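(* Let $k$ be an algebraically closed field of characteristic $p>0$. The complete list of rational numbers that are $F$-pure thresholds of a reduced homogeneous polynomial of degree $8$ in $k[x,y]$ is: (a) if $p=2$: $\frac14$; (b) if $p\equiv 1\pmod 4$: $\frac14$ and $\frac{p-1}{4p}$; (c) if $p\equiv 3\pmod 4$: $\frac14$, $\frac{p-3}{4p}$, and $\frac{p^2-1}{4p^2}$ for $p>3$, but only $\frac14$ and $\frac29$ when $p=3$.
   Context: A nonzero homogeneous polynomial is reduced if it has no repeated irreducible factors. For a nonzero homogeneous $f\in k[x,y]$ of positive degree, $\mathrm{fpt}(f)=\sup\{N/p^e : f^N\notin (x^{p^e},y^{p^e})\}=\inf\{N/p^e: f^N\in(x^{p^e},y^{p^e})\}$. *)

(* Defs.v *)
From mathcomp Require Import all_boot all_order all_algebra.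
From mathcomp Require Import classical_sets reals.
From mathcomp Require Import mpoly.

Set Implicit Arguments.
Unset Strict Implicit.
Unset Printing Implicit Defensive.

Import GRing.Theory.

Local Open Scope classical_set_scope.
Local Open Scope ring_scope.

Definition mpoly_irreducible (n : nat) (k : fieldType) (g : {mpoly k[n]}) :
    Prop :=
  [/\ g != 0, g \isn't a GRing.unit &
      forall a b : {mpoly k[n]}, g = a * b ->
        a \is a GRing.unit \/ b \is a GRing.unit].

Definition mpoly_reduced (n : nat) (k : fieldType) (f : {mpoly k[n]}) : Prop :=
  forall g : {mpoly k[n]}, mpoly_irreducible g ->
    ~ exists h : {mpoly k[n]}, f = g ^+ 2 * h.

(* The two variables x, y of k[x,y] are 'X_0 and 'X_1 in {mpoly k[2]}; this is
   membership in the ideal (x ^ q, y ^ q). *)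
Definition in_xq_yq (k : fieldType) (q : nat) (f : {mpoly k[2]}) : Prop :=
  exists a b : {mpoly k[2]},
    f = a * 'X_(0 : 'I_2) ^+ q + b * 'X_(1 : 'I_2) ^+ q.

(* [sup] is total. When f is a nonzero form of positive degree and p is the
   characteristic of k, the set below contains 0 (take N = 0) and is bounded
   above by 1, so [sup] is its genuine least upper bound. *)
Definition fpt (R : realType) (p : nat) (k : fieldType) (f : {mpoly k[2]}) :
    R :=
  sup [set t : R | exists N e : nat,
         ~ in_xq_yq (p ^ e) (f ^+ N) /\ t = N%:R / (p ^ e)%:R].

Arguments fpt R p {k} f.

Definition reduced_fpts (R : realType) (p : nat) (k : fieldType) (d : nat) :
    set R :=
  [set t : R | exists f : {mpoly k[2]},
     [/\ f != 0, f \is d.-homog, mpoly_reduced f & fpt R p f = t]].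

Arguments reduced_fpts R p k d : clear implicits.

(* Main.v *)
(* Put F = f(x, 1) and q = p ^ e: f ^ N lies in (x ^ q, y ^ q) iff the coefficient
   of X ^ i in F ^ N vanishes for 8 N - q < i < q.  If p does not divide N and 8 (N + 1) <= 2 q + 1, differentiating a relation
   f ^ N = a x ^ q + b y ^ q gives, for degree reasons, f a' = N f' a and
   f b' = N f' b; as f is reduced, f divides a and b, whence f ^ (N - 1) already
   lies in (x ^ q, y ^ q).  Therefore fpt f is either 1/4 or a truncation
   floor(p ^ L / 4) / p ^ L with L minimal, and periodicity of the base p
   expansion of 1/4 forces L <= 2.

   The values 1/4 and L = 1 are realized by x^8 + z x^4 y^4 + y^8, where the only
   relevant coefficient is a monic polynomial in z.  For L = 2, p > 3, one starts
   from the nonreduced form x^3 y^3 (x + y)^2, which has the required vanishing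
   because the binomial coefficient (2N choose N) is 0 mod p, and deforms it in
   (x^3 + t y^3) (y^3 + t x^3) (x^2 + z x y + y^2) along the curve of (t, z) on
   which this vanishing persists. *)
From HB Require Import structures.
Require Import Defs.
From mathcomp Require Import all_boot all_order all_algebra.
From mathcomp Require Import classical_sets reals.
From mathcomp Require Import mpoly.
From mathcomp Require Import zify ring lra.

Set Implicit Arguments.
Unset Strict Implicit.
Unset Printing Implicit Defensive.

Import Order.TTheory GRing.Theory Num.Theory.

Local Open Scope classical_set_scope.
Local Open Scope ring_scope.

(** * Dehomogenized forms and Frobenius powers *)

(** The Frobenius map is additive, so [G ^+ (p ^ s)] is obtained by raising each monomial of [G] to
    that power. *)
Lemma coef_exp_pchar (R : comNzRingType) (p s : nat) (G : {poly R}) i :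
    p \in [pchar R] ->
  (G ^+ (p ^ s))`_i =
    if (p ^ s %| i)%N then G`_(i %/ p ^ s) ^+ (p ^ s) else 0.
Proof.
move=> pch; have p_pr := pcharf_prime pch.
have pchP : p \in [pchar {poly R}] by rewrite pchar_poly.
set q := (p ^ s)%N; have q0 : (0 < q)%N by rewrite expn_gt0 prime_gt0.
have nq : [pchar {poly R}].-nat q by rewrite pnatX; apply/orP; left; rewrite pnatE.
elim/poly_ind: G i => [|G c IH] i.
  by rewrite expr0n eqn0Ngt q0 !coef0 expr0n eqn0Ngt q0 /= if_same.
rewrite exprDn_pchar // exprMn -polyC_exp coefD coefMXn coefC.
case: ltnP => [iq|qi].
  rewrite add0r; case: eqP => [->|/eqP i0].
    by rewrite dvdn0 div0n coefD coefMX coefC add0r.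
  by rewrite gtnNdvd // lt0n.
rewrite ifN; last by rewrite -lt0n; exact: leq_trans qi.
rewrite addr0 IH dvdn_subl ?dvdnn //; case: ifP => // _.
have -> : (i %/ q)%N = ((i - q) %/ q).+1.
  by rewrite -{1}(subnK qi) divnDr // divnn q0 addn1.
by rewrite coefD coefMX coefC /= addr0.
Qed.

(** The power of [G] lives in exponents [v * p ^ s]. A term with [v > u] would need a negative
    exponent in [H], because [i < p ^ s], and one with [v < u] is excluded by the size of [H]. This
    is the no-carry principle behind Lucas' theorem. *)
Lemma coef_exp_pcharM (R : comNzRingType) (p s : nat) (G H : {poly R}) u i :
    p \in [pchar R] -> (i < p ^ s)%N -> (size H <= p ^ s + i)%N ->
  (G ^+ (p ^ s) * H)`_(u * p ^ s + i) = G`_u ^+ (p ^ s) * H`_i.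
Proof.
move=> pch; have p_pr := pcharf_prime pch.
have r0 : (0 < p ^ s)%N by rewrite expn_gt0 prime_gt0.
have coefE := fun j => coef_exp_pchar s G j pch.
set r := (p ^ s)%N in r0 coefE * => iq sH; rewrite coefM.
have ur : (u * r < (u * r + i).+1)%N by rewrite ltnS leq_addr.
rewrite (bigD1 (Ordinal ur)) //= coefE dvdn_mull // mulnK // addKn.
rewrite big1 ?addr0 // => j.
rewrite -val_eqE /= => jur; rewrite coefE.
case: ifP => [/dvdnP[v jv]|_]; last by rewrite mul0r.
have := ltn_ord j; rewrite jv ltnS => vle.
have vu : (v < u)%N.
  rewrite ltn_neqAle; apply/andP; split.
    by apply: contraNneq jur => vu; rewrite jv vu.
  by rewrite -ltnS -(ltn_pmul2r r0) mulSn; apply: leq_ltn_trans vle _; lia.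
rewrite [X in _ * X]nth_default ?mulr0 //.
by apply: leq_trans sH _; rewrite leq_subRL //; nia.
Qed.

Lemma size_exp_le (R : nzRingType) (F : {poly R}) d N :
  (size F <= d.+1)%N -> (size (F ^+ N) <= (d * N).+1)%N.
Proof.
move=> sF; elim: N => [|N IH]; first by rewrite expr0 size_poly1 muln0.
rewrite exprS (leq_trans (size_polyMleq _ _)) // mulnS; lia.
Qed.

Lemma coefM_top (R : nzRingType) (P Q : {poly R}) m n :
  (size P <= m.+1)%N -> (size Q <= n.+1)%N -> (P * Q)`_(m + n) = P`_m * Q`_n.
Proof.
move=> sP sQ; rewrite coefM.
have mlt : (m < (m + n).+1)%N by rewrite ltnS leq_addr.
rewrite (bigD1 (Ordinal mlt)) //= addKn big1 ?addr0 // => j.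
rewrite -val_eqE /= neq_ltn => /orP[jm|mj].
  rewrite [X in _ * X]nth_default ?mulr0 // (leq_trans sQ) //.
  by rewrite -addnBAC ?(ltnW jm) // -addn1 addnC leq_add2r subn_gt0.
by rewrite nth_default ?mul0r // (leq_trans sP).
Qed.

Lemma coefXM_deriv (R : nzRingType) (P : {poly R}) i :
  ('X * P^`())`_i = P`_i *+ i.
Proof. by rewrite coefXM; case: i => [|i] //=; rewrite coef_deriv. Qed.

Lemma size_XM_deriv (R : nzRingType) (P : {poly R}) m :
  (size P <= m)%N -> (size ('X * P^`())%R <= m)%N.
Proof.
move=> sP; apply/leq_sizeP => j mj.
by rewrite coefXM_deriv nth_default ?mul0rn // (leq_trans sP).
Qed.

(* [logder N F B] is [F ^+ N.+1] times the derivative of [B / F ^+ N]. *)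
Definition logder (R : nzRingType) N (F B : {poly R}) :=
  F * B^`() - F^`() * B *+ N.

Lemma logder_top (R : comNzRingType) N (F B : {poly R}) m r :
    (size F <= m.+1)%N -> (size B <= r.+1)%N ->
  (size ('X * logder N F B)%R <= (m + r).+1)%N
  /\ ('X * logder N F B)`_(m + r) = F`_m * B`_r * (r%:R - (N * m)%:R).
Proof.
move=> sF sB.
have -> : 'X * logder N F B = F * ('X * B^`()) - ('X * F^`()) * B *+ N.
  by rewrite /logder mulrBr mulrCA mulrnAr (mulrA 'X F^`()).
have [sXF sXB] := (size_XM_deriv sF, size_XM_deriv sB).
split.
  rewrite (leq_trans (size_polyD _ _)) // geq_max size_polyN.
  have sM (P Q : {poly R}) : (size P <= m.+1)%N -> (size Q <= r.+1)%N ->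
      (size (P * Q)%R <= (m + r).+1)%N.
    by move=> sP sQ; rewrite (leq_trans (size_polyMleq _ _)) //; lia.
  rewrite sM //= -scaler_nat (leq_trans (size_scale_leq _ _)) // sM //.
rewrite coefB coefMn !coefM_top // !coefXM_deriv natrM.
rewrite -(mulr_natr _ N) -(mulr_natr B`_r) -(mulr_natr F`_m); ring.
Qed.

(* The form of degree [d] with dehomogenization [F] has its [N]-th power in
   [(x ^ q, y ^ q)]: the coefficient of [x ^ i * y ^ (d * N - i)] vanishes as
   soon as both exponents are less than [q]. *)
Definition pow_in (R : nzRingType) (d : nat) (F : {poly R}) (N q : nat) :=
  [forall i : 'I_q, (d * N < q + i)%N ==> ((F ^+ N)`_i == 0)].

Section PowIn.

Variables (k : fieldType) (d : nat) (F : {poly k}).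

Lemma pow_inP N q :
  reflect (forall i, (i < q)%N -> (d * N < q + i)%N -> (F ^+ N)`_i = 0)
          (pow_in d F N q).
Proof.
apply: (iffP forallP) => [h i iq dN|h i].
  by have /implyP/(_ dN)/eqP := h (Ordinal iq).
by apply/implyP => dN; apply/eqP/h.
Qed.

Lemma pow_inPn N q :
  reflect (exists i, [/\ (i < q)%N, (d * N < q + i)%N & (F ^+ N)`_i != 0])
          (~~ pow_in d F N q).
Proof.
rewrite negb_forall; apply: (iffP existsP) => [[i]|[i [iq dN nz]]].
  by rewrite negb_imply => /andP[? ?]; exists i.
by exists (Ordinal iq); rewrite negb_imply dN.
Qed.

Lemma pow_in_big N q : (2 * q <= (d * N).+1)%N -> pow_in d F N q.
Proof. by move=> h; apply/pow_inP => i iq; lia. Qed.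

Hypothesis sF : (size F <= d.+1)%N.

Lemma pow_inS N q : pow_in d F N q -> pow_in d F N.+1 q.
Proof.
move/pow_inP => h; apply/pow_inP => i iq dN.
rewrite exprS coefM big1 // => j _.
have [jd|dj] := ltnP d j; first by rewrite nth_default ?mul0r // (leq_trans sF).
rewrite h ?mulr0 //.
  by apply: leq_ltn_trans iq; exact: leq_subr.
have := ltn_ord j; rewrite mulnS in dN; lia.
Qed.

Lemma pow_in_le N N' q : (N <= N')%N -> pow_in d F N q -> pow_in d F N' q.
Proof.
by move=> /subnK <-; elim: (_ - _)%N => // n IH /IH; exact: pow_inS.
Qed.

Variable p : nat.
Hypothesis pch : p \in [pchar k].

Let p_pr : prime p := pcharf_prime pch.

Lemma pow_in0 e : ~~ pow_in d F 0 (p ^ e).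
Proof.
have q0 : (0 < p ^ e)%N by rewrite expn_gt0 prime_gt0.
apply/pow_inPn; exists 0%N; rewrite q0 muln0 addn0 q0 expr0 coef1 /=.
by split=> //; exact: oner_neq0.
Qed.

(** Coefficients of [F ^+ (N * p)] are [p]-th powers of those of [F ^+ N], placed at multiples of
    [p]; a field has no nilpotents, so vanishing transfers both ways. *)
Lemma pow_in_pchar N e :
  pow_in d F (N * p) (p ^ e.+1) = pow_in d F N (p ^ e).
Proof.
have p0 := prime_gt0 p_pr.
have coefE i : (F ^+ (N * p))`_i = if (p %| i)%N then (F ^+ N)`_(i %/ p) ^+ p else 0.
  by rewrite exprM -{1}(expn1 p) coef_exp_pchar // expn1.
apply/pow_inP/pow_inP => h i iq dN.
  have := h (i * p)%N; rewrite coefE dvdn_mull // mulnK // => hh.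
  apply/eqP; suff: (F ^+ N)`_i ^+ p == 0 by rewrite expf_eq0 p0.
  by rewrite hh // expnSr -?mulnDl ?mulnA ltn_pmul2r.
rewrite coefE; case: ifP => // /dvdnP[j ij]; rewrite ij mulnK //.
move: iq dN; rewrite ij expnSr mulnA -mulnDl !ltn_pmul2r // => iq dN.
by rewrite h // expr0n eqn0Ngt p0.
Qed.

(** Witnesses [u] and [i] combine into [u * p ^ s + i]: the range condition on [i] is exactly the
    size bound under which the coefficient there is a product of two nonzero ones. *)
Lemma pow_in_comb a b e s :
  ~~ pow_in d F a (p ^ e) -> ~~ pow_in d F b (p ^ s) ->
  ~~ pow_in d F (a * p ^ s + b) (p ^ (e + s)).
Proof.
move=> /pow_inPn[u [uq du nu]] /pow_inPn[i [iq di ni]].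
have r0 : (0 < p ^ s)%N by rewrite expn_gt0 prime_gt0.
apply/pow_inPn; exists (u * p ^ s + i)%N; rewrite expnD.
move: (iq) (di); set r := (p ^ s)%N in r0 * => iq' di'; split; [nia|nia|].
rewrite exprD exprM coef_exp_pcharM ?mulf_neq0 ?expf_neq0 //.
exact: leq_trans (size_exp_le b sF) di.
Qed.

Lemma pow_in_pred N e :
    F != 0 -> coprimep F F^`() -> (d <= size F)%N -> ~~ (p %| N)%N ->
    (d * N.+1 <= (2 * p ^ e.+1).+1)%N ->
  pow_in d F N (p ^ e.+1) -> pow_in d F N.-1 (p ^ e.+1).
Proof.
move=> F0 sepF dF pN; set q := (p ^ e.+1)%N => dN /pow_inP TN.
have q0 : q%:R = 0 :> k by rewrite natrX pcharf0 // expr0n.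
have N0 : N%:R != 0 :> k by rewrite -(dvdn_pcharf pch).
have Npos : (0 < N)%N by case: (N) pN => //; rewrite dvdn0.
(* Otherwise the range covers every coefficient and [F ^+ N] would be zero. This makes [r] a true
   difference. *)
have qdN : (q <= d * N)%N.
  rewrite leqNgt; apply/negP => dNq.
  have /eqP : F ^+ N = 0; last by rewrite expf_eq0 (negPf F0) andbF.
  apply/polyP => i; rewrite coef0; have [iq|qi] := ltnP i q.
    by rewrite TN // (leq_trans dNq) // leq_addr.
  by rewrite nth_default // (leq_trans (size_exp_le N sF)) // (leq_trans dNq).
set r := (d * N - q)%N.
(* This is the relation [f ^ N = a x ^ q + b y ^ q] with [y = 1]: [B] collects the exponents below
   [q], whose surviving monomials are divisible by [y ^ q]. *)
pose A := drop_poly q (F ^+ N); pose B := take_poly q (F ^+ N).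
have E : B + A * 'X^q = F ^+ N by exact: poly_take_drop.
have sB : (size B <= r.+1)%N.
  apply/leq_sizeP => j rj; rewrite coef_take_poly; case: ifP => // jq.
  by rewrite TN // -leq_subLR subSn.
have rE : r%:R = (N * d)%:R :> k by rewrite natrB // q0 subr0 mulnC.
have E' : logder N F B = - (logder N F A * 'X^q).
  have := congr1 (fun P => F * P^`()) E.
  rewrite derivD derivM derivXn -mulr_natr -polyC_natr q0 mulr0 mulr0 addr0.
  rewrite deriv_exp mulrnAr mulrCA -exprS prednK // -E /logder => h.
  have {}h : F * B^`() = F^`() * (B + A * 'X^q) *+ N - F * A^`() * 'X^q.
    by rewrite -h; ring.
  rewrite h -(mulr_natr (F^`() * B)) -(mulr_natr (F^`() * A)).
  by rewrite -(mulr_natr (F^`() * _)); ring.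
have [sV topV] := logder_top N sF sB.
(* Since [r] equals [N * d] in [k], the top term of ['X * logder N F B] cancels and its size is at
   most [d + r <= q + 1]; a nonzero multiple of ['X^q.+1] has size at least [q + 2]. *)
have W0 : logder N F A = 0.
  apply/eqP; apply/negPn/negP => Wn0.
  have : (size ('X * logder N F B)%R <= d + r)%N.
    apply/leq_sizeP => j; rewrite leq_eqVlt => /orP[/eqP<-|drj].
      by rewrite topV rE subrr mulr0.
    by rewrite nth_default // (leq_trans sV).
  rewrite E' mulrN size_polyN mulrC size_mulX; last first.
    by rewrite mulf_neq0 // -size_poly_gt0 size_polyXn.
  rewrite size_mulXn //; have : (0 < size (logder N F A))%N by rewrite size_poly_gt0.
  rewrite mulnS in dN; lia.
have V0 : logder N F B = 0 by rewrite E' W0 mul0r oppr0.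
have dvd P : logder N F P = 0 -> F %| P.
  move=> /eqP; rewrite subr_eq0 => /eqP h.
  rewrite -(Gauss_dvdpr _ sepF) -(dvdpZr _ _ N0) scaler_nat.
  by rewrite -h dvdp_mulr.
have /dvdpP[A1 A1E] := dvd _ W0; have /dvdpP[B1 B1E] := dvd _ V0.
have E1 : F ^+ N.-1 = B1 + A1 * 'X^q.
  apply: (mulIf F0); rewrite -exprSr prednK // -E A1E B1E; ring.
apply/pow_inP => i iq di; rewrite E1 coefD coefMXn iq addr0.
(* If [F] has degree [d], the bound on [B] suffices. If the degree is [d - 1], that is, if [y]
   divides the form, one more degree is needed: the top coefficient of ['X * logder N F B] is now
   [N] times a nonzero multiple of [B]_r[, so]B[_r] vanishes. *)
have sB1 : (size B < i + size F)%N.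
  have dN1 : (d * N = d + d * N.-1)%N by rewrite -{1}(prednK Npos) mulnS.
  have [sFd|sFd] := eqVneq (size F) d.+1; first by rewrite sFd; lia.
  have sFE : size F = d by apply/eqP; rewrite eqn_leq dF andbT -ltnS ltn_neqAle sFd.
  have d0 : (0 < d)%N by rewrite -sFE size_poly_gt0.
  have sF1 : (size F <= d.-1.+1)%N by rewrite prednK // sFE.
  have [_] := logder_top N sF1 sB.
  rewrite V0 mulr0 coef0 rE -natrB ?leq_mul2l ?leq_pred ?orbT //.
  rewrite -mulnBr -subn1 subKn // muln1 => /esym/eqP.
  have lF : F`_d.-1 != 0 by rewrite -sFE -lead_coefE lead_coef_eq0.
  rewrite !mulf_eq0 (negPf N0) orbF subn1 (negPf lF) /= => /eqP Br.
  have : (size B <= r)%N.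
    apply/leq_sizeP => j; rewrite leq_eqVlt => /orP[/eqP<- //|rj].
    by rewrite nth_default // (leq_trans sB).
  rewrite sFE /r dN1; move: (size B) (d * N.-1)%N di => b c di. lia.
apply: nth_default; move: sB1; rewrite B1E.
have [->|B10] := eqVneq B1 0; first by rewrite size_poly0.
rewrite size_mul //.
have : (0 < size B1)%N by rewrite size_poly_gt0.
have : (0 < size F)%N by rewrite size_poly_gt0.
by move: (size B1) (size F) => a b; lia.
Qed.

End PowIn.

(** * Forms of degree eight *)

Section Octic.

Variables (k : fieldType) (p : nat) (F : {poly k}).
Hypotheses (pch : p \in [pchar k]) (sF : (size F <= 9)%N) (dF : (8 <= size F)%N).
Hypothesis sepF : coprimep F F^`().

Local Notation T N e := (pow_in 8 F N (p ^ e)).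

Let p_pr : prime p := pcharf_prime pch.
Let p0 : (0 < p)%N := prime_gt0 p_pr.

Let F0 : F != 0.
Proof. by rewrite -size_poly_gt0 (leq_trans _ dF). Qed.

(* A minimal [N] with [T N e.+1] in this range is a multiple of [p], by
   [pow_in_pred], and then [N %/ p] already works for [p ^ e]. *)
Lemma pow_in_lift K K' e :
    (0 < K)%N -> ~~ T K.-1 e -> (K' <= K * p)%N -> (4 * K' <= p ^ e.+1)%N ->
  ~~ T K'.-1 e.+1.
Proof.
move=> K0 nT KK' dK'; apply/negP => TK.
have [N TN minN] := ex_minnP (ex_intro (fun N => T N e.+1) _ TK).
have N0 : (0 < N)%N by case: (N) TN => //; rewrite (negPf (pow_in0 _ _ pch _)).
have NK := minN _ TK.
have [/dvdnP[N' NE]|pN] := boolP (p %| N)%N; last first.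
  have bnd : (8 * N.+1 <= (2 * p ^ e.+1).+1)%N by lia.
  by have := minN _ (pow_in_pred sF pch F0 sepF dF pN bnd TN); lia.
move: TN; rewrite NE (pow_in_pchar _ _ pch) => TN'; case/negP: nT.
apply: pow_in_le TN' => //; rewrite -ltnS prednK // -(ltn_pmul2r p0) -NE.
by apply: leq_ltn_trans NK _; case: (K') KK' NE => [|n] //; lia.
Qed.

Lemma pow_in_pcharX N e s : T (N * p ^ s) (e + s) = T N e.
Proof.
elim: s => [|s IH]; first by rewrite muln1 addn0.
by rewrite addnS expnSr mulnA (pow_in_pchar _ _ pch).
Qed.

(** This is the lower bound for the threshold once the truncation of [1/4] at level [L.+1] is the
    first to give membership. Iterating [pow_in_lift] keeps the predecessor of the truncation,
    scaled by [p ^ s], outside the ideal. *)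
Lemma pow_in_first L s :
    ~~ T (p ^ L %/ 4) L -> T (p ^ L.+1 %/ 4) L.+1 ->
  ~~ T (p ^ L.+1 %/ 4 * p ^ s).-1 (L.+1 + s).
Proof.
move=> nT TS; elim: s => [|s IH].
  rewrite muln1 addn0; apply: (@pow_in_lift (p ^ L %/ 4).+1) => //.
    have := ltn_ceil (p ^ L) (isT : 0 < 4)%N; rewrite expnSr => h.
    apply: leq_trans (_ : ((p ^ L %/ 4).+1 * 4 * p) %/ 4 <= _)%N.
      by rewrite leq_div2r // leq_mul2r (ltnW h) orbT.
    by rewrite mulnAC mulnK.
  by rewrite mulnC leq_trunc_div.
rewrite addnS; apply: pow_in_lift IH _ _.
- rewrite muln_gt0 expn_gt0 p0 andbT lt0n; apply: contraTneq TS => ->.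
  by rewrite (negPf (pow_in0 _ _ pch _)).
- by rewrite -mulnA -expnSr.
- by rewrite mulnA -addnS expnD leq_mul2r mulnC leq_trunc_div orbT.
Qed.

(** Here [4 * 2 ^ e] is exactly [2 ^ e.+2], so [pow_in_lift] applies at every level, starting from
    the zeroth power at level 2. *)
Lemma pow_in_char2 e : p = 2 -> ~~ T (2 ^ e).-1 e.+2.
Proof.
move=> p2; elim: e => [|e IH]; first exact: (pow_in0 _ _ pch).
apply: pow_in_lift IH _ _; rewrite ?expn_gt0 // p2 -?expnSr //.
by rewrite -(expnD 2 2).
Qed.

Lemma modn4_expn e : (p = 1 %[mod 4])%N -> (p ^ e = 1 %[mod 4])%N.
Proof. by move=> p1; rewrite -modnXm p1 modnXm exp1n. Qed.

(** The base [p] expansion of [1/4] has the constant digit [p %/ 4], so [pow_in_comb] appends one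
    digit at a time. *)
Lemma pow_in_1mod4 e :
  (p = 1 %[mod 4])%N -> ~~ T (p %/ 4) 1 -> ~~ T (p ^ e %/ 4) e.
Proof.
move=> p1 nT; elim: e => [|e IH]; first exact: (pow_in0 _ _ pch).
have := pow_in_comb sF pch IH (_ : ~~ T (p %/ 4) 1); rewrite expn1 addn1.
have qe := modn4_expn e p1; rewrite expnSr => /(_ nT).
suff -> : (p ^ e * p %/ 4 = p ^ e %/ 4 * p + p %/ 4)%N by [].
rewrite [in LHS](divn_eq (p ^ e) 4) qe /= mulnDl mul1n mulnAC divnDl ?dvdn_mull //.
by rewrite mulnK.
Qed.

(** Membership at level 1 passes to level 2 after multiplying the exponent by [p], and
    [p %/ 4 * p <= p ^ 2 %/ 4]. *)
Lemma pow_in_3mod4_1 :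
  ~~ T (p ^ 2 %/ 4) 2 -> ~~ T (p %/ 4) 1.
Proof.
apply: contra => T1.
have := T1; rewrite -(pow_in_pcharX _ _ 1) => /(pow_in_le sF); apply.
rewrite expn1 leq_divRL // -mulnn mulnAC leq_mul2r orbC.
by rewrite leq_trunc_div.
Qed.

(** As [p ^ 2] is 1 modulo 4, the expansion of [1/4] has period two: blocks of two digits are
    appended, and one last digit when the level is odd. *)
Lemma pow_in_3mod4 e :
  (p = 3 %[mod 4])%N -> ~~ T (p ^ 2 %/ 4) 2 -> ~~ T (p ^ e %/ 4) e.
Proof.
move=> p3 nT; have nT1 := pow_in_3mod4_1 nT.
have p2 : (p ^ 2 = 1 %[mod 4])%N by rewrite -modnXm p3.
have step j s : ~~ T (p ^ (2 * j) %/ 4) (2 * j) ->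
    ~~ T (p ^ s %/ 4) s -> ~~ T (p ^ (2 * j + s) %/ 4) (2 * j + s).
  move=> nj ns; have := pow_in_comb sF pch nj ns.
  suff -> : (p ^ (2 * j + s) %/ 4 = p ^ (2 * j) %/ 4 * p ^ s + p ^ s %/ 4)%N by [].
  have qe : (p ^ (2 * j) = 1 %[mod 4])%N.
    by rewrite expnM -modnXm p2 modnXm exp1n.
  rewrite expnD [in LHS](divn_eq (p ^ (2 * j)) 4) qe /= mulnDl mul1n mulnAC.
  by rewrite divnDl ?dvdn_mull // mulnK.
have even j : ~~ T (p ^ (2 * j) %/ 4) (2 * j).
  elim: j => [|j IH]; first exact: (pow_in0 _ _ pch).
  by have := step j 2 IH nT; rewrite -mulnSr.
rewrite -(odd_double_half e) -mul2n addnC; case: (odd e).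
  by apply: step => //; rewrite expn1.
by rewrite addn0.
Qed.

End Octic.

(** * Suprema of fractions with denominators powers of [p] *)

Section Threshold.

Variables (R : realType) (p : nat) (U : nat -> nat -> Prop).
Hypothesis p_gt1 : (1 < p)%N.

Lemma sup_eq_lim (t : R) (N : nat -> nat) (e0 : nat) :
    (forall N e, U N e -> N%:R / (p ^ e)%:R <= t) ->
    (forall e, U (N e) (e0 + e)) ->
    (forall e, t * (p ^ (e0 + e))%:R <= (N e).+1%:R) ->
  sup [set s : R | exists N e : nat, U N e /\ s = N%:R / (p ^ e)%:R] = t.
Proof.
move=> ub UN lim; set S := [set s | _].
have pe0 e : 0 < (p ^ e)%:R :> R by rewrite ltr0n expn_gt0 ltnW.
have ubS : ubound S t by move=> s [M [e [UM ->]]]; exact: ub.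
apply/eqP; rewrite eq_le ge_sup //=; last first.
  by exists ((N 0)%:R / (p ^ (e0 + 0))%:R), (N 0), (e0 + 0)%N.
rewrite leNgt; apply/negP => lt_t.
(* The level is chosen so that [1 / p ^ (e0 + e)] is smaller than the supposed gap [t - sup S],
   whereas the element of the set at this level is within that distance of [t]. *)
pose e := Num.bound ((t - sup S)^-1).
have dpos : 0 < t - sup S by rewrite subr_gt0.
have be : (t - sup S)^-1 < (p ^ (e0 + e))%:R.
  rewrite (lt_le_trans (archi_boundP _)) ?invr_ge0 ?(ltW dpos) // ler_nat.
  by rewrite (leq_trans (ltnW (ltn_expl e p_gt1))) // leq_exp2l // leq_addl.
have : (N e)%:R / (p ^ (e0 + e))%:R <= sup S.
  by apply: ub_le_sup; [exists t|exists (N e), (e0 + e)%N].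
rewrite ler_pdivrMr // leNgt => /negP; apply.
have := lim e; rewrite -natr1 -lerBlDr => /(lt_le_trans _); apply.
rewrite ltrBrDl -ltrBrDr -mulrBl -(ltr_pdivrMl _ _ dpos) mulr1 //.
Qed.

End Threshold.

(** * Dehomogenization *)

Section Dehomogenization.

Variable k : fieldType.
Implicit Types (f g : {mpoly k[2]}) (P Q : {poly k}) (m : 'X_{1..2}).

Lemma mdeg2 m : mdeg m = (m 0%R + m 1%R)%N.
Proof. by rewrite mdegE big_ord_recl big_ord1; congr (_ + m _)%N; exact: val_inj. Qed.

Definition dehom : {mpoly k[2]} -> {poly k} :=
  mmap (@polyC k) (fun i : 'I_2 => if i == 0 then 'X else 1).

HB.instance Definition _ := GRing.RMorphism.on dehom.

Lemma dehomE f : dehom f = \sum_(m <- msupp f) f@_m *: 'X^(m 0).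
Proof.
rewrite /dehom /mmap; apply: eq_bigr => m _.
by rewrite /mmap1 big_ord_recl big_ord1 /= expr1n mulr1 mul_polyC.
Qed.

Lemma dehomXU i : dehom 'X_i = if i == 0 then 'X else 1.
Proof. by rewrite /dehom mmapX mmap1U. Qed.

Lemma dehomZ c f : dehom (c *: f) = c *: dehom f.
Proof. by rewrite -mul_mpolyC rmorphM /= /dehom mmapC mul_polyC. Qed.

Lemma mnm2P m m' : m 0 = m' 0 -> mdeg m = mdeg m' -> m = m'.
Proof.
move=> e0; rewrite !mdeg2 e0 => /addnI e1; apply/mnmP => i.
have [->|->] // : i = 0 \/ i = 1.
by case: i => -[|[|]] // i2; [left|right]; exact: val_inj.
Qed.

(** Monomials of the same degree are separated by their exponent of [x], so no two terms of a form
    merge when [y] becomes 1. *)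
Lemma coef_dehom d f m :
  f \is d.-homog -> mdeg m = d -> (dehom f)`_(m 0) = f@_m.
Proof.
move=> /dhomogP hf dm; rewrite dehomE coef_sum [in RHS](mpolyE f).
rewrite [in RHS]raddf_sum /=; apply: eq_big_seq => m' m'f.
rewrite coefZ coefXn mcoeffZ mcoeffX eq_sym; congr (_ * (nat_of_bool _)%:R).
apply/eqP/eqP => [e|-> //]; apply: (mnm2P e).
by rewrite dm; exact: hf.
Qed.

Lemma size_dehom_le f : (size (dehom f) <= msize f)%N.
Proof.
rewrite dehomE; apply: (leq_trans (size_sum _ _ _)); rewrite msizeE.
apply/bigmax_leqP_seq => m mf _; apply: leq_trans (size_scale_leq _ _) _.
rewrite size_polyXn; apply: leq_trans (leq_bigmax_seq _ mf isT).
by rewrite ltnS mdeg2 leq_addr.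
Qed.

Lemma size_dehom d f : f \is d.-homog -> (size (dehom f) <= d.+1)%N.
Proof.
move=> /dhomogP hf; apply: leq_trans (size_dehom_le f) _; rewrite msizeE.
by apply/bigmax_leqP_seq => m mf _; rewrite ltnS hf.
Qed.

Lemma dehom_inj d f g :
  f \is d.-homog -> g \is d.-homog -> dehom f = dehom g -> f = g.
Proof.
move=> hf hg e; apply/mpolyP => m; have [dm|dm] := eqVneq (mdeg m) d.
  by rewrite /= -(coef_dehom hf dm) e (coef_dehom hg dm).
by rewrite /= (dhomog_nemf_coeff hf dm) (dhomog_nemf_coeff hg dm).
Qed.

Definition hom d P : {mpoly k[2]} :=
  \sum_(i < d.+1) P`_i *: ('X_0 ^+ i * 'X_1 ^+ (d - i)).

Lemma hom_homog d P : hom d P \is d.-homog.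
Proof.
apply: rpred_sum => i _; apply: rpredZ.
have hX j n : ('X_j ^+ n : {mpoly k[2]}) \is n.-homog.
  rewrite mpolyXn dhomogX; apply/eqP.
  exact: etrans (mdegMn _ _) (etrans (congr1 (muln^~ n) (mdeg1 _)) (mul1n n)).
have := dhomogM (hX 0 i) (hX 1 (d - i)%N).
by rewrite subnKC // -ltnS.
Qed.

Lemma homK d P : (size P <= d.+1)%N -> dehom (hom d P) = P.
Proof.
move=> sP; rewrite /hom rmorph_sum /=.
transitivity (\poly_(i < d.+1) P`_i).
  rewrite poly_def; apply: eq_bigr => i _.
  by rewrite dehomZ rmorphM !rmorphXn /= !dehomXU /= expr1n mulr1.
apply/polyP => i; rewrite coef_poly; case: ltnP => // di.
by rewrite nth_default // (leq_trans sP).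
Qed.

Lemma mcoeffMXn (a : {mpoly k[2]}) i q m :
  (m i < q)%N -> (a * 'X_i ^+ q)@_m = 0.
Proof.
move=> mq; rewrite mpolyXn mcoeffM big1 // => -[m1 m2] /= /eqP mE.
rewrite mcoeffX; case: eqP => [e|_]; last by rewrite mulr0.
move: mq; rewrite (congr1 (fun x : 'X_{1..2} => x i) mE) mnmDE -e mulmnE mnm1E.
by rewrite eqxx mul1n ltnNge leq_addl.
Qed.

Lemma in_xq_yqP q f :
  in_xq_yq q f <-> forall m, (m 0%R < q)%N -> (m 1%R < q)%N -> f@_m = 0.
Proof.
split=> [[a [b ->]] m m0 m1|h]; first by rewrite mcoeffD !mcoeffMXn ?addr0.
have split i m : (q <= m i)%N ->
    'X_[m] = 'X_[m - U_(i) *+ q] * 'X_i ^+ q :> {mpoly k[2]}.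
  move=> qm; rewrite mpolyXn -mpolyXD submK //; apply/mnm_lepP => j.
  by rewrite mulmnE mnm1E; case: eqP => [<-|]; rewrite ?mul1n ?mul0n.
(* Monomials divisible by [x ^ q] go to the first summand. The others go to the second, where those
   not divisible by [y ^ q] have coefficient zero by hypothesis. *)
exists (\sum_(m <- msupp f | (q <= m 0%R)%N) f@_m *: 'X_[m - U_(0) *+ q]).
exists (\sum_(m <- msupp f | ~~ (q <= m 0%R)%N) f@_m *: 'X_[m - U_(1) *+ q]).
rewrite [LHS]mpolyE (bigID (fun m : 'X_{1..2} => q <= m 0%R)%N) /= !mulr_suml.
congr (_ + _); apply: eq_bigr => m qm.
  by rewrite (split _ _ qm) scalerAl.
rewrite -scalerAl; have [q1|q1] := leqP q (m 1%R); first by rewrite -split.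
by rewrite h ?scale0r // ltnNge.
Qed.

Lemma in_xq_yq_pow d f N q :
  f \is d.-homog -> in_xq_yq q (f ^+ N) <-> pow_in d (dehom f) N q.
Proof.
move=> hf; have hN := dhomogMn N hf.
have FN : dehom f ^+ N = dehom (f ^+ N) by rewrite rmorphXn.
split=> [/in_xq_yqP h|/pow_inP h].
  apply/pow_inP => i iq di; rewrite FN; have [idN|dNi] := leqP i (d * N)%N; last first.
    by rewrite nth_default // (leq_trans (size_dehom hN)).
  pose m : 'X_{1..2} := [multinom if j == 0%R then i else (d * N - i)%N | j < 2].
  have m0 : m 0 = i by rewrite mnmE.
  have m1 : m 1 = (d * N - i)%N by rewrite mnmE.
  rewrite -{1}m0 (coef_dehom hN) ?mdeg2 ?m0 ?m1 ?subnKC //.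
  by rewrite h ?m0 ?m1 // ltn_subLR // addnC.
apply/in_xq_yqP => m m0 m1; have [dm|dm] := eqVneq (mdeg m) (d * N)%N.
  rewrite -(coef_dehom hN dm) -FN h // -dm mdeg2; lia.
by rewrite (dhomog_nemf_coeff hN dm).
Qed.

Lemma hom_irreducible f : f != 0 -> f \is 1.-homog -> mpoly_irreducible f.
Proof.
move=> f0 hf; have sf : msize f = 2.
  by have := dhomog_uniq f0 hf (dhomog_msize hf); rewrite /= => /esym; lia.
split=> // [|a b fE].
  apply/negP => /andP[/eqP fc _]; move: sf; rewrite fc msizeC; case: eqP => //.
have [a0 b0] : a != 0 /\ b != 0.
  by split; apply: contraNneq f0 => e; rewrite fE e ?mul0r ?mulr0.
have unit g : msize g = 1%N -> g \is a GRing.unit.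
  move/eqP/msize_poly1P => [c c0 ->]; apply/andP; rewrite mcoeffC eqxx mulr1.
  by rewrite eqxx unitfE.
move: sf; rewrite fE msizeM //.
have : (0 < msize a)%N by rewrite lt0n msize_poly_eq0.
have : (0 < msize b)%N by rewrite lt0n msize_poly_eq0.
case: (msize a) (unit a) => [|[|n]] // ua; first by left; apply: ua.
case: (msize b) (unit b) => [|[|m]] // ub; first by right; apply: ub.
by lia.
Qed.

End Dehomogenization.

(** A square factor [g ^+ 2] makes [dehom g] divide both [P] and its derivative, hence constant.
    What remains is [g] losing its degree when [y = 1], as a power of [y] does; the lower bound on
    [size P] excludes it. *)
Lemma reduced_hom (k : fieldType) d (P : {poly k}) :
    (d <= size P <= d.+1)%N -> coprimep P P^`() ->
  hom d P != 0 /\ mpoly_reduced (hom d P).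
Proof.
move=> /andP[dP Pd] sepP; have PK := homK Pd; set f := hom d P in PK *.
have P0 : P != 0.
  apply: contraTneq sepP => ->.
  by rewrite deriv0 /coprimep gcdp0 size_poly0.
have f0 : f != 0 by apply: contraNneq P0 => f0; rewrite -PK f0 rmorph0.
split=> // g [g0 gU _] [h fE].
have h0 : h != 0 by apply: contraNneq f0 => h0; rewrite fE h0 mulr0.
have PE : P = dehom g ^+ 2 * dehom h by rewrite -PK fE rmorphM rmorphXn.
have /eqP sG : size (dehom g) == 1%N.
  rewrite -dvdp1; rewrite /coprimep size_poly_eq1 in sepP.
  rewrite -(eqp_dvdr _ sepP) dvdp_gcd PE; apply/andP; split.
    by rewrite expr2 -mulrA dvdp_mulr.
  rewrite expr2 !derivM; apply: dvdp_add; apply: dvdp_mulr; last exact: dvdp_mulIl.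
  by apply: dvdp_add; [exact: dvdp_mulIr|exact: dvdp_mulIl].
have /size_poly1P[c c0 GE] : size (dehom g) == 1%N by rewrite sG.
(* With [dehom g] constant, [h] carries the full degree of [P], at least [d - 1], so the square
   [g ^+ 2] has degree at most 1. *)
have sH : (d <= msize h)%N.
  apply: leq_trans (size_dehom_le h); rewrite (leq_trans dP) // PE GE.
  by rewrite -rmorphXn mul_polyC size_scale // expf_neq0.
have sf : msize f = d.+1.
  have := dhomog_uniq f0 (hom_homog d P) (dhomog_msize (hom_homog d P)).
  rewrite /= => ->; rewrite prednK // lt0n msize_poly_eq0 //.
have g20 : g ^+ 2 != 0 by rewrite expf_neq0.
move: sf; rewrite fE msizeM // expr2 msizeM // => sf.
case/negP: gU; have /msize_poly1P[e e0 ->] : msize g == 1%N.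
  have : (0 < msize g)%N by rewrite lt0n msize_poly_eq0.
  by move: (msize g) (msize h) sH sf => a b; lia.
by apply/andP; rewrite mcoeffC eqxx mulr1 eqxx unitfE.
Qed.

(** The square of the linear form [hom 1 P] divides [f]. Allowing [P] constant covers the factor
    [y], whose dehomogenization is 1. *)
Lemma hom_sqr_dvd (k : fieldType) d f (P Q : {poly k}) :
    f \is d.+2.-homog -> (0 < size P <= 2)%N -> (size Q <= d.+1)%N ->
    dehom f = P ^+ 2 * Q ->
  ~ mpoly_reduced f.
Proof.
move=> hf /andP[P0 sP] sQ fE red.
have irr : mpoly_irreducible (hom 1 P).
  apply: hom_irreducible; last exact: hom_homog.
  rewrite size_poly_gt0 in P0.
  by apply: contraNneq P0 => h0; rewrite -(homK sP) h0 rmorph0.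
apply: (red _ irr); exists (hom d Q); apply: (dehom_inj hf).
  rewrite -[d.+2]/(1 * 2 + d)%N; apply: dhomogM (hom_homog _ _).
  exact: dhomogMn (hom_homog _ _).
by rewrite rmorphM rmorphXn /= !homK.
Qed.

(** A drop of two degrees would mean a factor [y ^ 2], and a common root [a] of [dehom f] and its
    derivative a factor [(x - a y) ^ 2]. *)
Lemma reduced_dehom (k : closedFieldType) d (f : {mpoly k[2]}) :
    f != 0 -> f \is d.+2.-homog -> mpoly_reduced f ->
  (d.+2 <= size (dehom f) <= d.+3)%N /\ coprimep (dehom f) (dehom f)^`().
Proof.
move=> f0 hf red; have sF := size_dehom hf.
have F0 : dehom f != 0.
  apply: contraNneq f0 => F0; apply/eqP; apply: (dehom_inj hf).
    exact: dhomog0.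
  by rewrite rmorph0.
rewrite sF andbT; split.
  rewrite leqNgt; apply/negP => sF'.
  apply: (@hom_sqr_dvd _ d f 1 (dehom f)) red => //; first by rewrite size_poly1.
  by rewrite expr1n mul1r.
rewrite /coprimep; apply/negPn/negP => /closed_rootP[a].
rewrite root_gcd => /andP[/factor_theorem[H FE]].
rewrite FE derivM derivXsubC mulr1 rootE hornerD hornerM hornerXsubC subrr mulr0.
rewrite add0r => /factor_theorem[Q HE].
apply: (@hom_sqr_dvd _ d f ('X - a%:P) Q) red => //.
- by rewrite size_XsubC.
- have Q0 : Q != 0 by apply: contraNneq F0 => Q0; rewrite FE HE Q0 !mul0r.
  move: sF; rewrite FE HE !size_mul ?mulf_neq0 ?polyXsubC_eq0 // size_XsubC.
  by rewrite !addn2 /=.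
- by rewrite FE HE; ring.
Qed.

(** * Possible values *)

Section FptOctic.

Variables (R : realType) (k : fieldType) (p : nat) (f : {mpoly k[2]}).
Hypotheses (pch : p \in [pchar k]) (hf : f \is 8.-homog).
Hypothesis dF : (8 <= size (dehom f))%N.
Hypothesis sepF : coprimep (dehom f) (dehom f)^`().

Local Notation T N e := (pow_in 8 (dehom f) N (p ^ e)).

Let p_pr : prime p := pcharf_prime pch.
Let p0 : (0 < p)%N := prime_gt0 p_pr.
Let sF : (size (dehom f) <= 9)%N := size_dehom hf.

Let pe0 e : 0 < (p ^ e)%:R :> R.
Proof. by rewrite ltr0n expn_gt0 p0. Qed.

Lemma not_in_xq_yqP N e : ~ in_xq_yq (p ^ e) (f ^+ N) <-> ~~ T N e.
Proof.
have h := in_xq_yq_pow N (p ^ e) hf.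
by split=> [nin|/negP nT /h //]; apply/negP => /h.
Qed.

(** The bound [1/4] holds for every form of degree 8, since the range of coefficients is empty once
    [p ^ e < 4 * N]; the given exponents approach it from below. *)
Lemma fpt_eq_quarter (N : nat -> nat) (e0 : nat) :
    (forall e, ~~ T (N e) (e0 + e)) ->
    (forall e, p ^ (e0 + e) <= 4 * (N e).+1)%N ->
  fpt R p f = 1 / 4.
Proof.
move=> nT bN; apply: (sup_eq_lim (prime_gt1 p_pr) (N := N) (e0 := e0)).
- move=> M e /not_in_xq_yqP nTM; rewrite ler_pdivrMr //.
  have : (4 * M <= p ^ e)%N.
    rewrite leqNgt; apply/negP => lt; case/negP: nTM; apply: pow_in_big; lia.
  rewrite -(ler_nat R) natrM; lra.
- by move=> e; apply/not_in_xq_yqP.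
- by move=> e; have := bN e; rewrite -(ler_nat R) natrM; lra.
Qed.

(** The upper bound compares any other fraction with the truncation at the common level [e + L.+1];
    the lower bound is [pow_in_first]. *)
Lemma fpt_eq_trunc L :
    ~~ T (p ^ L %/ 4) L -> T (p ^ L.+1 %/ 4) L.+1 ->
  fpt R p f = (p ^ L.+1 %/ 4)%:R / (p ^ L.+1)%:R.
Proof.
move=> nT TK; set K := (p ^ L.+1 %/ 4)%N in TK *.
have K0 : (0 < K)%N.
  by rewrite lt0n; apply: contraTneq TK => ->; exact: pow_in0.
apply: (sup_eq_lim (prime_gt1 p_pr) (N := fun s => (K * p ^ s).-1) (e0 := L.+1)).
- move=> M e /not_in_xq_yqP nTM; rewrite ler_pdivrMr // mulrAC ler_pdivlMr //.
  rewrite -!natrM ler_nat leqNgt; apply/negP => lt; case/negP: nTM.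
  rewrite -(pow_in_pcharX _ pch _ _ L.+1); apply: (pow_in_le sF (ltnW lt)).
  by rewrite addnC pow_in_pcharX.
- by move=> s; apply/not_in_xq_yqP; exact: pow_in_first.
- move=> s; rewrite prednK ?muln_gt0 ?K0 ?expn_gt0 ?p0 //.
  by rewrite expnD !natrM mulrA divfK // gt_eqF.
Qed.

Lemma fpt_char2 : p = 2%N -> fpt R p f = 1 / 4.
Proof.
move=> p2; apply: (@fpt_eq_quarter (fun e => (2 ^ e).-1) 2) => e.
  exact: pow_in_char2.
by rewrite prednK ?expn_gt0 // p2 expnD.
Qed.

Lemma fpt_quarter_of : (forall e, ~~ T (p ^ e %/ 4) e) -> fpt R p f = 1 / 4.
Proof.
move=> nT; apply: (@fpt_eq_quarter (fun e => (p ^ e %/ 4)%N) 0) => e //.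
by rewrite mulnC ltnW // ltn_ceil.
Qed.

Lemma natr_trunc4 r : (p = r %[mod 4])%N -> (r < 4)%N ->
  (p %/ 4)%:R = (p%:R - r%:R) / 4 :> R.
Proof.
move=> pr r4; have := divn_eq p 4; rewrite pr (modn_small r4) => pE.
by rewrite [in RHS]pE natrD natrM addrK mulfK ?pnatr_eq0.
Qed.

Lemma fpt_1mod4 : (p = 1 %[mod 4])%N ->
  fpt R p f = if T (p %/ 4) 1 then (p%:R - 1) / (4 * p%:R) else 1 / 4.
Proof.
move=> p1; case: ifP => [T1|/negbT nT1].
  rewrite (@fpt_eq_trunc 0) ?expn1 ?(pow_in0 _ _ pch) //.
  by rewrite (natr_trunc4 p1) // -mulrA -invfM.
by apply: fpt_quarter_of => e; exact: pow_in_1mod4.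
Qed.

Lemma fpt_3mod4 : (p = 3 %[mod 4])%N ->
  fpt R p f = if T (p %/ 4) 1 then (p%:R - 3) / (4 * p%:R)
              else if T (p ^ 2 %/ 4) 2 then (p%:R ^+ 2 - 1) / (4 * p%:R ^+ 2)
              else 1 / 4.
Proof.
move=> p3; case: ifP => [T1|/negbT nT1].
  rewrite (@fpt_eq_trunc 0) ?expn1 ?(pow_in0 _ _ pch) //.
  by rewrite (natr_trunc4 p3) // -mulrA -invfM.
case: ifP => [T2|/negbT nT2]; last first.
  by apply: fpt_quarter_of => e; exact: pow_in_3mod4.
rewrite (@fpt_eq_trunc 1) ?expn1 // -natrX.
have : (p ^ 2 = 1 %[mod 4])%N by rewrite -modnXm p3.
move: (p ^ 2)%N => q q1; have := divn_eq q 4; rewrite q1 => qE.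
by rewrite [in X in _ = (X - _) / _]qE natrD natrM addrK invfM mulrA mulfK ?pnatr_eq0.
Qed.

End FptOctic.

(** * Realizing the values *)

Lemma coef_XaddC_exp (R : comNzRingType) (c : R) n i :
  (('X + c%:P) ^+ n)`_i = c ^+ (n - i) *+ 'C(n, i).
Proof.
rewrite addrC exprDn coef_sum.
under eq_bigr => j _ do rewrite coefMn -polyC_exp coefCM coefXn.
have [ni|ni] := ltnP n i.
  rewrite bin_small // mulr0n big1 // => j _.
  by rewrite (gtn_eqF (leq_trans (ltn_ord j) ni)) mulr0 mul0rn.
rewrite (bigD1 (Ordinal (ni : i < n.+1)%N)) //= eqxx mulr1 big1 ?addr0 // => j.
by rewrite -val_eqE /= eq_sym => /negPf->; rewrite mulr0 mul0rn.
Qed.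

Lemma prime_dvd_fact p m : prime p -> (p %| m`!)%N -> (p <= m)%N.
Proof.
move=> p_pr; elim: m => [|m IH].
  by rewrite fact0 dvdn1 => /eqP p1; rewrite p1 in p_pr.
rewrite factS Euclid_dvdM // => /orP[/dvdn_leq-> //|/IH pm].
exact: leqW.
Qed.

(** * Binomial coefficients modulo [p] *)

Section Binomial.

Variables (k : fieldType) (p : nat).
Hypothesis pch : p \in [pchar k].

Lemma natr_bin_neq0 m i : (m < p)%N -> (i <= m)%N -> 'C(m, i)%:R != 0 :> k.
Proof.
move=> mp im; rewrite -(dvdn_pcharf pch); apply: contraL mp => pC.
rewrite -leqNgt; apply: prime_dvd_fact (pcharf_prime pch) _.
by rewrite -(bin_fact im) dvdn_mulr.
Qed.

(** Lucas' theorem, read off from [(X + 1) ^ (a p + b)] as the [p]-th power of [(X + 1) ^ a] times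
    [(X + 1) ^ b]; Frobenius fixes the image of an integer. *)
Lemma Lucas_bin a b c d : (b < p)%N -> (d < p)%N ->
  'C(a * p + b, c * p + d)%:R = 'C(a, c)%:R * 'C(b, d)%:R :> k.
Proof.
move=> bp dp.
have E n i : 'C(n, i)%:R = (('X + 1%:P) ^+ n : {poly k})`_i.
  by rewrite coef_XaddC_exp expr1n.
have := @coef_exp_pcharM _ p 1 (('X + 1%:P) ^+ a : {poly k}) (('X + 1%:P) ^+ b) c d pch.
rewrite expn1 -exprM -exprD -!E => -> //; last first.
  rewrite (leq_trans (@size_exp_le _ _ 1 b _)) ?size_XaddC // mul1n.
  by rewrite (leq_trans bp) // leq_addr.
by rewrite -(pFrobenius_autE pch) pFrobenius_aut_nat.
Qed.

End Binomial.

Section Pencil.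

(* The coefficient of ['X^m] in [(U + z *: V) ^+ n], as a polynomial in [z]. *)
Definition pencil (R : comNzRingType) (U V : {poly R}) n m : {poly R} :=
  \poly_(j < n.+1) ((U ^+ (n - j) * V ^+ j)`_m *+ 'C(n, j)).

Variable R : comNzRingType.
Implicit Types (U V : {poly R}).

Lemma horner_pencil U V n m z : (pencil U V n m).[z] = ((U + z *: V) ^+ n)`_m.
Proof.
rewrite horner_poly exprDn coef_sum; apply: eq_bigr => j _.
by rewrite coefMn exprZn -scalerAr coefZ mulrnAl mulrC.
Qed.

Lemma lead_coef_pencil U V n m : (V ^+ n)`_m != 0 ->
  lead_coef (pencil U V n m) = (V ^+ n)`_m /\ size (pencil U V n m) = n.+1.
Proof.
move=> V0; have e : (U ^+ (n - n) * V ^+ n)`_m *+ 'C(n, n) = (V ^+ n)`_m.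
  by rewrite subnn mul1r binn.
by split; rewrite ?lead_coef_poly ?size_poly_eq //= e.
Qed.

Lemma map_pencil (S : comNzRingType) (h : {rmorphism R -> S}) U V n m :
  map_poly h (pencil U V n m) = pencil (map_poly h U) (map_poly h V) n m.
Proof.
apply/polyP => j; rewrite coef_map !coef_poly; case: ifP => _; last exact: rmorph0.
by rewrite raddfMn /= -coef_map rmorphM !rmorphXn.
Qed.

End Pencil.

Lemma coprimep_deriv_closed (k : closedFieldType) (P : {poly k}) :
  (forall a, P.[a] = 0 -> P^`().[a] != 0) -> coprimep P P^`().
Proof.
move=> sepP; rewrite /coprimep; apply/negPn/negP => /closed_rootP[a].
by rewrite root_gcd !rootE => /andP[/eqP/sepP/negPf->].
Qed.

(** * The forms [x^8 + z x^4 y^4 + y^8] *)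

Section Quartic.

Variable k : closedFieldType.

(** The central trinomial coefficient of [(X^2 + z X + 1) ^ n], monic of degree [n] in [z]. *)
Definition central (n : nat) : {poly k} := pencil ('X^2 + 1) 'X n n.

Lemma size_central n : size (central n) = n.+1.
Proof.
have [] // := @lead_coef_pencil k ('X^2 + 1) 'X n n.
by rewrite coefXn eqxx oner_neq0.
Qed.

Lemma central_sqr n c : c ^+ 2 = 1 -> (central n).[2 * c] = c ^+ n *+ 'C(2 * n, n).
Proof.
move=> c1; rewrite horner_pencil.
have -> : 'X^2 + 1 + (2 * c) *: 'X = ('X + c%:P) ^+ 2.
  by rewrite -mul_polyC rmorphM /= sqrrD -polyC_exp c1 polyC_natr; ring.
by rewrite -exprM coef_XaddC_exp; congr (_ ^+ _ *+ _); lia.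
Qed.

(** Composition with ['X^4] places the coefficients of the powers at multiples of 4. *)
Definition quartic (z : k) : {poly k} := ('X^2 + 1 + z *: 'X) \Po 'X^4.

Lemma quarticE z : quartic z = 'X^8 + (z *: 'X^4 + 1).
Proof.
rewrite /quartic !comp_polyD comp_polyZ comp_polyX comp_Xn_poly -exprM.
by rewrite -polyC1 comp_polyC; ring.
Qed.

Lemma size_quartic z : size (quartic z) = 9%N.
Proof.
rewrite quarticE size_polyDl size_polyXn // ltnS (leq_trans (size_polyD _ _)) //.
by rewrite geq_max size_poly1 (leq_trans (size_scale_leq _ _)) // size_polyXn.
Qed.

Lemma central_nonroot n : exists2 z, z ^+ 2 != 4 & (central n).[z] != 0.
Proof.
have c0 : central n != 0 by rewrite -size_poly_gt0 size_central.
have /closed_nonrootP[z] : central n * ('X^2 - 4%:P) != 0.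
  by rewrite mulf_neq0 // -size_poly_gt0 size_XnsubC.
rewrite rootE hornerM mulf_eq0 negb_or => /andP[cz z4].
by exists z => //; move: z4; rewrite hornerD hornerN hornerXn hornerC subr_eq0.
Qed.

Variable p : nat.
Hypothesis p_odd : odd p.

(** With [q = 4 n + r] and [r] odd below 4, the range is [4 n - r < i < 4 n + r], in which [4 n] is
    the only multiple of 4. *)
Lemma pow_in_quartic z e :
  pow_in 8 (quartic z) (p ^ e %/ 4) (p ^ e) = ((central (p ^ e %/ 4)).[z] == 0).
Proof.
set q := (p ^ e)%N; have q_odd : odd q by rewrite oddX p_odd orbT.
set n := (q %/ 4)%N.
have [r [r4 r_odd qE]] : exists r, [/\ (r < 4)%N, odd r & q = (n * 4 + r)%N].
  exists (q %% 4)%N; rewrite ltn_mod -divn_eq; split=> //.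
  by move: (q_odd); rewrite {1}(divn_eq q 4) oddD oddM andbF.
have coefE i : (quartic z ^+ n)`_i =
    if (4 %| i)%N then (('X^2 + 1 + z *: 'X) ^+ n)`_(i %/ 4) else 0.
  by rewrite /quartic -(rmorphXn (comp_poly 'X^4)) coef_comp_poly_Xn.
apply/pow_inP/eqP => h.
  have := h (n * 4)%N; rewrite coefE dvdn_mull // mulnK // horner_pencil => -> //.
    by rewrite qE -{1}[(n * 4)%N]addn0 ltn_add2l; case: (r) r_odd.
  by rewrite qE; case: (r) r_odd => // r' _; lia.
move=> i iq di; rewrite coefE; case: ifP => // /dvdnP[j ij].
suff -> : i = (n * 4)%N by rewrite mulnK // -horner_pencil.
rewrite ij qE in iq di *.
by case: r r4 r_odd iq di {qE} => [|[|[|[|]]]] // _ _; lia.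
Qed.

Hypothesis pch : p \in [pchar k].

Let two0 : 2%:R != 0 :> k.
Proof.
rewrite -(dvdn_pcharf pch); apply: contraTN p_odd => /dvdn_leq.
by move=> /(_ isT); have := prime_gt1 (pcharf_prime pch); case: (p) => [|[|[|]]].
Qed.

(** A double root [a] is nonzero and satisfies [z = - 2 a^4]; then [z^2 - 4] is [-4] times the value
    of the polynomial at [a]. *)
Lemma coprimep_quartic z : z ^+ 2 != 4 -> coprimep (quartic z) (quartic z)^`().
Proof.
move=> z4; apply: coprimep_deriv_closed => a; rewrite quarticE.
rewrite !derivE !hornerE /= => Fa; apply: contraNneq z4 => F'a.
have a0 : a != 0.
  by apply: contra_eq_neq Fa => ->; rewrite !expr0n /= mulr0 !add0r oner_neq0.
have z0 : 2 * a ^+ 4 + z = 0.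
  have : (2 ^+ 2 * a ^+ 3) * (2 * a ^+ 4 + z) = 0 by rewrite -F'a; ring.
  move/eqP; rewrite mulf_eq0.
  by rewrite (negPf (mulf_neq0 (expf_neq0 _ two0) (expf_neq0 _ a0))) => /eqP.
have zE : z = - (2 * a ^+ 4) by apply/eqP; rewrite -addr_eq0 addrC z0.
rewrite -subr_eq0; apply/eqP.
have -> : z ^+ 2 - 4 = - 4 * (a ^+ 8 + (z * a ^+ 4 + 1)) by rewrite zE; ring.
by rewrite (_ : _ + _ = 0) ?mulr0 // -Fa; ring.
Qed.

(** At [z = 2] and [z = -2] the value is, up to sign, the central binomial coefficient of [2 n],
    nonzero because [2 n < p]. Hence no root is one of these two points. *)
Lemma central_root n : (0 < n)%N -> (2 * n < p)%N ->
  exists2 z, z ^+ 2 != 4 & (central n).[z] = 0.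
Proof.
move=> n0 np; have /closed_rootP[z /eqP cz] : size (central n) != 1%N.
  by rewrite size_central eqSS -lt0n.
exists z => //.
apply: contraTneq (natr_bin_neq0 pch np (leq_pmull n (isT : 0 < 2)%N)) => z4.
rewrite negbK.
have c1 : (z / 2) ^+ 2 = 1.
  by rewrite expr_div_n z4 (_ : 4 = 2 ^+ 2) ?divff ?expf_neq0 //; ring.
have c0 : z / 2 != 0.
  by apply: contra_eq_neq c1 => ->; rewrite expr0n eq_sym oner_neq0.
have := central_sqr n c1; rewrite mulrC divfK // cz -mulr_natr => /esym/eqP.
by rewrite mulf_eq0 expf_eq0 (negPf c0) andbF.
Qed.

End Quartic.

(** If all roots of [P] were roots of [Q], then each linear factor of [P] would divide [Q], and [P]
    has fewer than [size P] of them. *)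
Lemma root_not_root (k : closedFieldType) (P Q : {poly k}) :
    P != 0 -> ~~ (P %| Q ^+ (size P)) ->
  exists2 z, P.[z] = 0 & Q.[z] != 0.
Proof.
move=> P0; have [r PE] := closed_field_poly_normal P.
have Pr x : x \in r -> P.[x] = 0.
  move=> xr; rewrite PE hornerZ; apply/eqP; rewrite mulf_eq0.
  by rewrite -[_.[x] == 0]/(root _ x) root_prod_XsubC xr orbT.
have [/allP Qr|/allPn[z zr Qz] _] := boolP (all (fun x => Q.[x] == 0) r); last first.
  by exists z => //; exact: Pr.
case/negP; apply: dvdp_trans (_ : P %| Q ^+ size r) (dvdp_exp2l _ _); last first.
  rewrite [X in (_ <= size (polyseq X))%N]PE size_scale ?lead_coef_eq0 //.
  by rewrite size_prod_XsubC.
rewrite PE dvdpZl ?lead_coef_eq0 //.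
elim: r {PE Pr} Qr => [|x r IH] Qr; first by rewrite big_nil dvd1p.
rewrite big_cons exprS dvdp_mul ?IH //.
  by rewrite dvdp_XsubCl rootE Qr ?mem_head.
by move=> y yr; rewrite Qr // inE yr orbT.
Qed.

(* The curve [P = 0] cannot be contained in [Q = 0] over infinitely many [t]:
   otherwise [P] divides a power of [Q] up to a factor [lead_coef P ^+ s], and
   one could specialize at [(0, z0)]. *)
Lemma specialize_root (k : closedFieldType) (P Q : {poly {poly k}}) (z0 : k) :
    (lead_coef P).[0] != 0 ->
    (map_poly (horner_eval 0) P).[z0] = 0 ->
    (map_poly (horner_eval 0) Q).[z0] != 0 ->
  exists2 D : {poly k}, D != 0 & forall t, D.[t] != 0 ->
    exists2 z, (map_poly (horner_eval t) P).[z] = 0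
             & (map_poly (horner_eval t) Q).[z] != 0.
Proof.
move=> lP P0 Q0; pose sp t := map_poly (horner_eval t) : {poly {poly k}} -> {poly k}.
have nzlP : lead_coef P != 0.
  by apply: contraNneq lP => ->; rewrite horner0.
have nzP : P != 0 by rewrite -lead_coef_eq0.
have := Pdiv.Idomain.divp_eq (Q ^+ (size P)) P.
set s := scalp _ _; set B := _ %/ _; set C := _ %% _ => E.
have sC : (size C < size P)%N by rewrite Pdiv.Idomain.ltn_modp.
have Esp t : (lead_coef P).[t] ^+ s *: sp t Q ^+ (size P) = sp t B * sp t P + sp t C.
  have := congr1 (sp t) E; rewrite /sp rmorphD rmorphM /= => <-.
  by rewrite map_polyZ !rmorphXn.
(* A zero pseudo-remainder, specialized at [t = 0] and [z = z0], would force [Q] or the leading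
   coefficient of [P] to vanish there. *)
have nzC : C != 0.
  apply: contraTneq (Q0) => C0; rewrite negbK.
  have := congr1 (horner^~ z0) (Esp 0).
  rewrite C0 /sp rmorph0 addr0 hornerZ hornerM P0 mulr0 horner_exp => /eqP.
  by rewrite mulf_eq0 !expf_eq0 (negPf lP) andbF /= => /andP[].
(* Away from the zeros of this product, [P] and [C] keep their degrees under specialization, so [P]
   still does not divide [C], nor therefore the power of [Q]. *)
exists (lead_coef P * lead_coef C); first by rewrite mulf_neq0 // lead_coef_eq0.
move=> t; rewrite hornerM mulf_eq0 negb_or => /andP[lPt lCt].
have sPt : size (sp t P) = size P by rewrite size_map_poly_id0.
have sCt : size (sp t C) = size C by rewrite size_map_poly_id0.
have nzPt : sp t P != 0 by rewrite -size_poly_gt0 sPt size_poly_gt0.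
apply: root_not_root => //; apply/negP; rewrite sPt => dvdPQ.
have : sp t P %| sp t C.
  rewrite -(dvdp_addr _ (dvdp_mulIr (sp t B) (sp t P))) -Esp.
  by rewrite dvdpZr // expf_neq0.
move/dvdp_leq; rewrite -size_poly_gt0 sCt sPt size_poly_gt0 => /(_ nzC).
by rewrite leqNgt sC.
Qed.

(** * Deformations of [x^3 y^3 (x + y)^2] *)

Section Sextic.

Variable R : comNzRingType.
Implicit Types t z : R.

Definition sextic t : {poly R} := ('X^3 + t%:P) * (1 + t *: 'X^3).

(** Expanded as [U + z *: V] so that [pencil] applies; [t = 0], [z = 2] gives the nonreduced
    [X^3 (X + 1)^2]. *)
Definition octic t z : {poly R} := sextic t * ('X^2 + 1) + z *: (sextic t * 'X).

Lemma octicE t z : octic t z = sextic t * ('X^2 + 1 + z *: 'X).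
Proof. by rewrite /octic [RHS]mulrDr -scalerAr. Qed.

End Sextic.

Lemma map_sextic (R S : comNzRingType) (h : {rmorphism R -> S}) t :
  map_poly h (sextic t) = sextic (h t).
Proof.
by rewrite /sextic rmorphM !rmorphD /= map_polyZ rmorph1 !map_polyXn map_polyC.
Qed.

Section OcticSeparable.

Variable k : closedFieldType.

(* Zero if [X ^ 2 + z * X + 1] and [sextic t] have a common root [a]: then [a ^ 3]
   is [- t] or [- t^-1], while [a ^ 3 + a ^- 3 = - z ^ 3 + 3 * z]. *)
Definition octic_res (t z : k) := t * (z ^+ 3 - 3 * z) - t ^+ 2 - 1.

Lemma size_octic (t z : k) : t != 0 -> size (octic t z) = 9%N.
Proof.
move=> t0; have s1 : size ('X^3 + t%:P) = 4%N by rewrite size_XnaddC.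
have s2 : size (1 + t *: 'X^3) = 4%N.
  by rewrite addrC size_polyDl size_scale // size_polyXn ?size_poly1.
have s3 : size ('X^2 + 1 + z *: 'X) = 3%N.
  rewrite -addrA size_polyDl size_polyXn // ltnS (leq_trans (size_polyD _ _)) //.
  by rewrite geq_max size_poly1 (leq_trans (size_scale_leq _ _)) // size_polyX.
have nz (P : {poly k}) n : size P = n.+1 -> P != 0.
  by move=> sP; rewrite -size_poly_gt0 sP.
rewrite octicE !size_mul ?mulf_neq0 ?(nz _ _ s1) ?(nz _ _ s2) ?(nz _ _ s3) //.
by rewrite s1 s2 s3.
Qed.

(** The factors [A], [B], [C] have simple roots and are pairwise without common root: [t ^+ 2 != 1]
    separates [A] from [B], [octic_res] separates both from [C], and [z ^+ 2 - 4] is the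
    discriminant of [C]. *)
Lemma coprimep_octic (t z : k) : 3%:R != 0 :> k ->
    t != 0 -> t ^+ 2 != 1 -> z ^+ 2 != 4 -> octic_res t z != 0 ->
  coprimep (octic t z) (octic t z)^`().
Proof.
move=> three0 t0 t1 z4 res; apply: coprimep_deriv_closed => a.
rewrite octicE /sextic !derivE !hornerE /=.
set A := a ^+ 3 + t; set B := 1 + t * a ^+ 3; set C := a ^+ 2 + 1 + z * a.
move=> F0.
have ABC : A * B * C = 0 by rewrite -F0 /A /B /C; ring.
set F' := (X in X != 0).
have F'E : F' = 3 * a ^+ 2 * B * C + A * (3 * t * a ^+ 2) * C + A * B * (2 * a + z).
  by rewrite /F' /A /B /C; ring.
have resE : (A = 0) \/ (B = 0) -> C != 0.
  move=> AB; apply: contraNneq res => C0.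
  have a0 : a != 0.
    apply: contra_eq_neq C0 => a0.
    by rewrite /C a0 expr0n mulr0 add0r addr0 oner_neq0.
  have za : z * a = - (a ^+ 2 + 1) by apply/eqP; rewrite -addr_eq0 addrC -/C C0.
  have : a ^+ 3 * octic_res t z = 0.
    have -> : a ^+ 3 * octic_res t z =
        t * ((z * a) ^+ 3 - 3 * a ^+ 2 * (z * a)) - (t ^+ 2 + 1) * a ^+ 3.
      by rewrite /octic_res; ring.
    rewrite za; case: AB => [A0|B0].
      have tE : t = - a ^+ 3 by apply/eqP; rewrite -addr_eq0 addrC -/A A0.
      by rewrite tE; ring.
    have -> : t * ((- (a ^+ 2 + 1)) ^+ 3 - 3 * a ^+ 2 * (- (a ^+ 2 + 1))) -
        (t ^+ 2 + 1) * a ^+ 3 = - (a ^+ 3 + t) * B by rewrite /B; ring.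
    by rewrite B0 mulr0.
  by move/eqP; rewrite mulf_eq0 expf_eq0 (negPf a0).
have BA : A = 0 -> B != 0.
  move=> A0; apply: contraNneq t1 => B0; rewrite -subr_eq0; apply/eqP.
  have -> : t ^+ 2 - 1 = t * A - B by rewrite /A /B; ring.
  by rewrite A0 B0 mulr0 subr0.
have a0 : A = 0 \/ B = 0 -> a != 0.
  move=> AB; apply: contraTneq isT => a0; case: AB.
    by rewrite /A a0 expr0n add0r => t00; rewrite t00 eqxx in t0.
  by rewrite /B a0 expr0n mulr0 addr0 => /eqP; rewrite oner_eq0.
move/eqP: ABC; rewrite !mulf_eq0 -orbA => /or3P[] /eqP H0; rewrite F'E H0.
- rewrite !mul0r !addr0 !mulf_neq0 ?expf_neq0 ?a0 ?BA ?resE //; by left.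
- rewrite !(mulr0, mul0r) add0r addr0 !mulf_neq0 ?expf_neq0 ?a0 ?resE //; try by right.
  by apply: contraTneq isT => A0; move: (BA A0); rewrite H0 eqxx.
- rewrite !mulr0 !add0r !mulf_neq0 //.
  + by apply: contraTneq isT => A0; move: (resE (or_introl A0)); rewrite H0 eqxx.
  + by apply: contraTneq isT => B0; move: (resE (or_intror B0)); rewrite H0 eqxx.
  apply: contraNneq z4 => zE; have {}zE : z = - (2 * a).
    by apply/eqP; rewrite -addr_eq0 addrC zE.
  rewrite -subr_eq0; apply/eqP.
  have -> : z ^+ 2 - 4 = - 4 * C by rewrite /C zE; ring.
  by rewrite H0 mulr0.
Qed.

End OcticSeparable.

Lemma sextic_exp (R : comNzRingType) (t : R) n :
  sextic t ^+ n = \sum_(i < n.+1) \sum_(j < n.+1)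
    (t ^+ (i + j) *+ ('C(n, i) * 'C(n, j))) *: 'X^(3 * (n - i) + 3 * j).
Proof.
rewrite exprMn !exprDn mulr_suml; apply: eq_bigr => i _.
rewrite mulr_sumr; apply: eq_bigr => j _.
rewrite expr1n mul1r exprZn -!exprM -polyC_exp -scalerMnl mulrnAl mulrnAr.
rewrite -mulrnA [('C(n, j) * _)%N]mulnC; congr (_ *+ _).
by rewrite [_ * (t ^+ i)%:P]mulrC mul_polyC -scalerAl -scalerAr scalerA !exprD.
Qed.

Lemma coef_sextic_exp (R : comNzRingType) (t : R) n m :
  (sextic t ^+ n * ('X + 1) ^+ (2 * n))`_m = \sum_(i < n.+1) \sum_(j < n.+1)
    t ^+ (i + j) *+ ('C(n, i) * 'C(n, j) *
      (if (m < 3 * (n - i) + 3 * j)%N then 0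
       else 'C(2 * n, m - (3 * (n - i) + 3 * j)))).
Proof.
rewrite sextic_exp mulr_suml coef_sum; apply: eq_bigr => i _.
rewrite mulr_suml coef_sum; apply: eq_bigr => j _.
rewrite -scalerAl coefZ coefXnM; case: ifP => _; first by rewrite muln0 mulr0.
by rewrite -polyC1 coef_XaddC_exp expr1n mulr_natr -mulrnA.
Qed.

Section OcticFamily.

Variables (k : closedFieldType) (p m : nat).
Hypotheses (pch : p \in [pchar k]) (pE : p = (4 * m + 3)%N) (m0 : (0 < m)%N).

(** This is [(p ^ 2 - 1) / 4], written with its base [p] digits [m] and [3 * m + 2]. *)
Let N := (m * p + (3 * m + 2))%N.

Let twoN : (2 * N = (2 * m + 1) * p + (2 * m + 1))%N.
Proof. by rewrite /N pE; lia. Qed.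

Let p_pr : prime p := pcharf_prime pch.

Let natr_neq0 n : (0 < n)%N -> (n < p)%N -> n%:R != 0 :> k.
Proof.
by move=> n0 np; rewrite -(dvdn_pcharf pch) gtnNdvd.
Qed.

(** The low digit [2 m + 1] of [2 N] is smaller than the low digit [3 m + 2] of [N]. *)
Lemma bin_central0 : 'C(2 * N, N)%:R = 0 :> k.
Proof.
rewrite twoN /N (Lucas_bin pch); [|by rewrite pE; lia..].
by rewrite (@bin_small (2 * m + 1) (3 * m + 2)) ?mulr0 //; lia.
Qed.

(** The shift is the first multiple of 3 exceeding [m]. It produces a carry, and the new digits
    [m + 1] and [2 - m %% 3] are at most the digits [2 m + 1] of [2 N]. *)
Lemma bin_shift_neq0 : 'C(2 * N, N + 3 * (m %/ 3).+1)%:R != 0 :> k.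
Proof.
have mE := divn_eq m 3; have r3 : (m %% 3 < 3)%N by rewrite ltn_mod.
have -> : (N + 3 * (m %/ 3).+1 = m.+1 * p + (2 - m %% 3))%N by rewrite /N pE; lia.
rewrite twoN (Lucas_bin pch); [|by rewrite pE; lia..].
by rewrite mulf_neq0 ?(natr_bin_neq0 pch) // ?pE; lia.
Qed.

Lemma bin_low_neq0 d : (d <= (m %/ 3).+1)%N -> 'C(N, d)%:R != 0 :> k.
Proof.
move=> dm; have m3 := leq_div m 3; have := Lucas_bin pch m 0.
move=> /(_ (3 * m + 2)%N d); rewrite mul0n add0n bin0 mul1r => -> //.
- by rewrite (natr_bin_neq0 pch) // ?pE; lia.
- by rewrite pE; lia.
- by rewrite pE; lia.
Qed.

(** The middle coefficient of [octic t z ^+ n]: the outer variable is [z], and the inner ['X] stands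
    for [t]. *)
Definition octic_coef n : {poly {poly k}} :=
  pencil (sextic 'X * ('X^2 + 1)) (sextic 'X * 'X) n (4 * n).

Lemma horner_octic_coef n t z :
  (map_poly (horner_eval t) (octic_coef n)).[z] = (octic t z ^+ n)`_(4 * n).
Proof.
have mapE P : map_poly (horner_eval t) (sextic 'X * P) =
    sextic t * map_poly (horner_eval t) P.
  by rewrite rmorphM /= map_sextic /= horner_evalE hornerX.
by rewrite map_pencil horner_pencil !mapE rmorphD rmorph1 /= map_polyXn map_polyX.
Qed.

(** At [t = 0] the coefficient of [z] becomes [X^4], whose [n]-th power is the monomial of degree
    [4 n]. *)
Lemma lead_octic_coef n : (lead_coef (octic_coef n)).[0] = 1.
Proof.
pose V : {poly {poly k}} := sextic 'X * 'X.
have V0 : ((V ^+ n)`_(4 * n)).[0] = 1.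
  rewrite -[_.[0]]/(horner_eval 0 _) -coef_map rmorphXn rmorphM /= map_sextic.
  rewrite map_polyX /= horner_evalE hornerX /sextic addr0 scale0r addr0 mulr1.
  by rewrite -exprSr -exprM coefXn eqxx.
have [|-> _ //] := @lead_coef_pencil _ (sextic 'X * ('X^2 + 1)) V n (4 * n).
apply: contraTneq isT => e; move: V0; rewrite e horner0 => /eqP.
by rewrite eq_sym oner_eq0.
Qed.

Lemma octic_coef0 n z :
  (map_poly (horner_eval 0) (octic_coef n)).[z] = (central k n).[z].
Proof.
rewrite horner_octic_coef octicE /sextic addr0 scale0r addr0 mulr1 horner_pencil.
rewrite exprMn -exprM coefXnM ltnNge leq_mul2r orbT /=.
by congr (_`_ _); rewrite -mulnBl mul1n.
Qed.

(* As a polynomial in [t], its lowest term has degree the least [d] such that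
   ['C(2 * N, N + 3 * d)] is nonzero mod [p]. *)
Lemma octic_coef2_neq0 : (octic_coef N).[2] != 0.
Proof.
pose b n : k := 'C(2 * N, N + 3 * n)%:R.
have exb : exists n, b n != 0 by exists (m %/ 3).+1; exact: bin_shift_neq0.
have [d bd bmin] := ex_minnP exb.
have dm : (d <= (m %/ 3).+1)%N by apply: bmin; exact: bin_shift_neq0.
have d0 : (0 < d)%N.
  by rewrite lt0n; apply: contraNneq bd => ->; rewrite /b muln0 addn0 bin_central0.
have dN : (3 * d <= N)%N by have := leq_div m 3; rewrite /N; lia.
have b0 n : (n < d)%N -> b n = 0.
  by move=> nd; apply/eqP; apply: contraTT nd => /bmin; rewrite -leqNgt.
have bN0 n : (n < d)%N -> 'C(2 * N, N - 3 * n)%:R = 0 :> k.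
  move=> nd; rewrite -(b0 n nd) /b -bin_sub; last by lia.
  by congr ('C(_, _)%:R); lia.
have bNd : 'C(2 * N, N - 3 * d)%:R = b d.
  by rewrite /b -bin_sub; [congr ('C(_, _)%:R); lia | lia].
suff : ((octic_coef N).[2])`_d != 0 by apply: contraNneq => ->; rewrite coef0.
have -> : (octic_coef N).[2] = (sextic 'X ^+ N * ('X + 1) ^+ (2 * N))`_(4 * N).
  rewrite horner_pencil -/(octic 'X 2) octicE exprMn exprM.
  congr ((_ * _ ^+ _ : {poly {poly k}})`_ _).
  by rewrite -mul_polyC polyC_natr; ring.
pose a i j : k := (d == (i + j)%N)%:R * ('C(N, i) * 'C(N, j) *
      (if (4 * N < 3 * (N - i) + 3 * j)%N then 0
       else 'C(2 * N, 4 * N - (3 * (N - i) + 3 * j))))%:R.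
(* If [i] and [j] are positive with sum [d], then their difference is less than [d] in absolute
   value, and the binomial vanishes by minimality of [d]. *)
have a0 i j : (0 < i)%N -> (0 < j)%N -> (i <= N)%N -> a i j = 0.
  move=> i0 j0 iN; rewrite /a; case: eqP => [dE|_]; last by rewrite mul0r.
  rewrite mul1r ifF; last by lia.
  rewrite natrM; have [ji|ij] := leqP j i.
    rewrite (_ : 4 * N - _ = N + 3 * (i - j))%N; last by lia.
    by rewrite -/(b (i - j)%N) b0 ?mulr0 //; lia.
  rewrite (_ : 4 * N - _ = N - 3 * (j - i))%N; last by lia.
  by rewrite bN0 ?mulr0 //; lia.
have an i j : d != (i + j)%N -> a i j = 0.
  by move=> /negPf dij; rewrite /a dij mul0r.
have -> : ((sextic 'X ^+ N * ('X + 1) ^+ (2 * N))`_(4 * N))`_d =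
    \sum_(i < N.+1) \sum_(j < N.+1) a i j.
  rewrite coef_sextic_exp coef_sum; apply: eq_bigr => i _; rewrite coef_sum.
  by apply: eq_bigr => j _; rewrite coefMn coefXn /a mulr_natr.
have dlt : (d < N.+1)%N by lia.
have ad : a 0%N d = 'C(N, d)%:R * b d.
  rewrite /a eqxx mul1r bin0 mul1n subn0 ifF ?natrM; last by lia.
  by rewrite (_ : 4 * N - _ = N - 3 * d)%N ?bNd //; lia.
have da : a d 0%N = 'C(N, d)%:R * b d.
  rewrite /a addn0 eqxx mul1r bin0 muln1 muln0 addn0 ifF ?natrM; last by lia.
  by rewrite (_ : 4 * N - _ = N + 3 * d)%N //; lia.
(* Only the pairs [(0, d)] and [(d, 0)] survive. By symmetry of the binomials they contribute
   equally, for a total of [2 * 'C(N, d) * b d]. *)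
rewrite (bigD1 ord0) //= [X in _ + X](bigD1 (Ordinal dlt)) -?val_eqE /= -?lt0n //.
rewrite [X in _ + (_ + X)]big1 ?addr0 => [|i]; last first.
  rewrite -!val_eqE /= => /andP[i0 id]; apply: big1 => j _.
  have [j0|j0] := posnP j; last by rewrite a0 // ?lt0n // -ltnS.
  by rewrite an // j0 addn0 eq_sym.
rewrite (bigD1 (Ordinal dlt)) //= big1 ?addr0 => [|j]; last first.
  by rewrite -val_eqE /= => jd; rewrite an // eq_sym.
rewrite (bigD1 ord0) //= big1 ?addr0 => [|j]; last first.
  by rewrite -val_eqE /= => j0; rewrite an // -[X in X != _]addn0 eqn_add2l eq_sym.
rewrite ad da -mulr2n -[_ *+ 2]mulr_natr !mulf_neq0 ?bin_low_neq0 //.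
by rewrite natr_neq0 // pE; lia.
Qed.

Lemma exists_octic : exists t z : k,
  [/\ size (octic t z) = 9%N, coprimep (octic t z) (octic t z)^`(),
      (octic t z ^+ N)`_(4 * N) = 0 & (octic t z ^+ m)`_(4 * m) != 0].
Proof.
pose res : {poly {poly k}} := 'X%:P * ('X^3 - 'X *+ 3) - 'X%:P ^+ 2 - 1.
(* The factors encode what must not vanish on the curve: the first prevents membership at level 1,
   the others serve separability. *)
pose Q := octic_coef m * ('X + 2) * res.
have resE t z : (map_poly (horner_eval t) res).[z] = octic_res t z.
  rewrite /res !(rmorphB, rmorphM, rmorphXn, rmorph1, raddfMn) /=.
  rewrite !map_polyX !map_polyC /= !horner_evalE !hornerX /octic_res.
  rewrite !(hornerD, hornerN, hornerM, hornerMn, hornerC, hornerX, horner_exp). ring.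
have QE t z : (map_poly (horner_eval t) Q).[z] =
    (octic t z ^+ m)`_(4 * m) * (z + 2) * octic_res t z.
  rewrite /Q !rmorphM !hornerM horner_octic_coef resE; congr (_ * _ * _).
  by rewrite rmorphD rmorph_nat /= map_polyX hornerD hornerX -polyC_natr hornerC.
have P2 : (map_poly (horner_eval 0) (octic_coef N)).[2] = 0.
  have := central_sqr N (expr1n k 2); rewrite mulr1 => e.
  by rewrite octic_coef0 e expr1n bin_central0.
have two0 : 2%:R != 0 :> k by rewrite natr_neq0 // pE; lia.
have three0 : 3%:R != 0 :> k by rewrite natr_neq0 // pE; lia.
have Q2 : (map_poly (horner_eval 0) Q).[2] != 0.
  rewrite QE -horner_octic_coef octic_coef0.
  have := central_sqr m (expr1n k 2); rewrite mulr1 expr1n => ->.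
  rewrite !mulf_neq0 //.
  - by rewrite (natr_bin_neq0 pch) // ?pE; lia.
  - by rewrite -natrD natr_neq0 // pE; lia.
  - by rewrite (_ : octic_res 0 2 = -1) ?oppr_eq0 ?oner_neq0 // /octic_res; ring.
have lP : (lead_coef (octic_coef N)).[0] != 0 by rewrite lead_octic_coef oner_neq0.
(* [z + 2] and [octic_res] do not vanish at [(0, 2)], unlike [z - 2], which is
   instead excluded by [octic_coef2_neq0]. *)
have [D D0 HD] := specialize_root lP P2 Q2.
(* Besides the zeros of [D], the parameter [t] avoids those where [z = 2] lies on the curve, and
   [0], [1], [-1]. *)
have nz : D * (octic_coef N).[2] * ('X * ('X^2 - 1%:P)) != 0.
  rewrite !mulf_neq0 ?octic_coef2_neq0 ?polyX_eq0 //.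
  by rewrite -size_poly_gt0 size_XnsubC.
have [t] := closed_nonrootP _ nz.
rewrite rootE !hornerM !mulf_eq0 !negb_or -andbA => /and4P[Dt ct tX t1].
have t0 : t != 0 by rewrite hornerX in tX.
have {}t1 : t ^+ 2 != 1 by rewrite hornerD hornerN hornerXn hornerC subr_eq0 in t1.
have [z] := HD t Dt; rewrite horner_octic_coef QE => Nz.
rewrite !mulf_eq0 !negb_or -andbA => /and3P[mz z2 rz].
exists t, z; split=> //; first exact: size_octic.
apply: coprimep_octic => //; rewrite -subr_eq0.
have -> : z ^+ 2 - 4 = (z - 2) * (z + 2) by ring.
rewrite mulf_neq0 // subr_eq0; apply: contraNneq ct => z2E.
move: Nz; rewrite z2E -horner_octic_coef.
have := horner_map (horner_eval t) (octic_coef N) 2.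
by rewrite rmorph_nat => -> /eqP.
Qed.

End OcticFamily.

(** * The set of thresholds in each characteristic *)

Section Existence.

Variables (R : realType) (k : closedFieldType) (p : nat).
Hypothesis pch : p \in [pchar k].

Let p_pr : prime p := pcharf_prime pch.

Lemma reduced_fpts_hom (P : {poly k}) : size P = 9%N -> coprimep P P^`() ->
  dehom (hom 8 P) = P /\ reduced_fpts R p k 8 (fpt R p (hom 8 P)).
Proof.
move=> sP sepP; rewrite homK ?sP //; split=> //.
have [|f0 red] := @reduced_hom _ 8 P _ sepP; first by rewrite sP.
by exists (hom 8 P); split=> //; exact: hom_homog.
Qed.

Lemma reduced_fptsP (t : R) : reduced_fpts R p k 8 t ->
  exists f : {mpoly k[2]}, [/\ f \is 8.-homog, (8 <= size (dehom f))%N,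
    coprimep (dehom f) (dehom f)^`() & fpt R p f = t].
Proof.
move=> [f [f0 hf red ft]]; have [/andP[sf _] sep] := reduced_dehom f0 hf red.
by exists f.
Qed.

Lemma quartic_mem (z : k) : odd p -> z ^+ 2 != 4 ->
  dehom (hom 8 (quartic z)) = quartic z /\
  reduced_fpts R p k 8 (fpt R p (hom 8 (quartic z))).
Proof.
move=> p_odd z4; apply: reduced_fpts_hom; first exact: size_quartic.
exact: (coprimep_quartic p_odd pch).
Qed.

(** For [F = X^8 + X] one has [8 F - X F' = 7 X], so a double root could only be 0, where the
    derivative is 1. *)
Lemma coprimep_X8DX : 7%:R != 0 :> k ->
  coprimep ('X^8 + 'X : {poly k}) ('X^8 + 'X)^`().
Proof.
move=> seven0; apply: coprimep_deriv_closed => a.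
rewrite !derivE !(hornerE, hornerXn, hornerMn) /= => Fa.
apply/eqP => F'a; have /eqP : 7 * a = 0.
  have -> : 7 * a = 8 * (a ^+ 8 + a) - a * (a ^+ 7 *+ 8 + 1) by ring.
  by rewrite Fa (_ : _ + 1 = 0) ?mulr0 ?subr0 // -F'a; ring.
rewrite mulf_eq0 (negPf seven0) => /eqP a0.
by move/eqP: F'a; rewrite a0 expr0n !addr0 add0r oner_eq0.
Qed.

Lemma size_X8DX : size ('X^8 + 'X : {poly k}) = 9%N.
Proof. by rewrite size_polyDl size_polyXn // size_polyX. Qed.

Lemma X8DX_mem : 7%:R != 0 :> k ->
  dehom (hom 8 ('X^8 + 'X)) = 'X^8 + 'X :> {poly k} /\
  reduced_fpts R p k 8 (fpt R p (hom 8 ('X^8 + 'X : {poly k}))).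
Proof.
by move=> seven0; apply: reduced_fpts_hom size_X8DX (coprimep_X8DX seven0).
Qed.

Lemma reduced_fpts_char2 : p = 2%N -> reduced_fpts R p k 8 = [set 1 / 4].
Proof.
move=> p2; apply/seteqP; split=> t /=.
  by move=> /reduced_fptsP[f [hf sf sep <-]]; exact: fpt_char2.
move=> ->; have [|dE] := @X8DX_mem; first by rewrite -(dvdn_pcharf pch) p2.
rewrite (fpt_char2 _ pch) ?hom_homog // dE ?size_X8DX //.
by apply: coprimep_X8DX; rewrite -(dvdn_pcharf pch) p2.
Qed.

Lemma odd_mod4 n : odd (n %% 4) = odd n.
Proof. by rewrite [in RHS](divn_eq n 4) oddD oddM andbF. Qed.

Lemma size_quartic_ge (z : k) : (8 <= size (quartic z))%N.
Proof. by rewrite size_quartic. Qed.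

(** One [z] with nonzero middle coefficient at level 2 suffices, as this also gives nonmembership at
    level 1. *)
Lemma quarter_mem : odd p -> (p = 1 %[mod 4])%N \/ (p = 3 %[mod 4])%N ->
  reduced_fpts R p k 8 (1 / 4).
Proof.
move=> p_odd p13.
have [z z4 nz] := central_nonroot k (p ^ 2 %/ 4).
have [dE] := quartic_mem p_odd z4.
have sep := coprimep_quartic p_odd pch z4.
have nT2 : ~~ pow_in 8 (quartic z) (p ^ 2 %/ 4) (p ^ 2).
  by rewrite (pow_in_quartic p_odd).
have nT1 : ~~ pow_in 8 (quartic z) (p %/ 4) (p ^ 1).
  by apply: (pow_in_3mod4_1 pch) nT2; rewrite size_quartic.
case: p13 => pm.
  rewrite (fpt_1mod4 R pch (hom_homog 8 _)) ?dE ?size_quartic_ge //.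
  by rewrite (negPf nT1).
rewrite (fpt_3mod4 R pch (hom_homog 8 _)) ?dE ?size_quartic_ge //.
by rewrite (negPf nT1) (negPf nT2).
Qed.

Lemma reduced_fpts_1mod4 : (p = 1 %[mod 4])%N ->
  reduced_fpts R p k 8 = [set 1 / 4; (p%:R - 1) / (4 * p%:R)].
Proof.
move=> p1; have p_odd : odd p by rewrite -odd_mod4 p1.
apply/seteqP; split=> t /=.
  move=> /reduced_fptsP[f [hf sf sep <-]].
  by rewrite (fpt_1mod4 R pch) //; case: ifP => _; [right|left].
case=> ->; first by apply: quarter_mem => //; left.
have pE := divn_eq p 4; rewrite p1 /= in pE.
have n0 : (0 < p %/ 4)%N.
  by rewrite lt0n; apply: contraTneq (prime_gt1 p_pr) => e; rewrite pE e.
have [z z4 cz] : exists2 z : k, z ^+ 2 != 4 & (central k (p %/ 4)).[z] = 0.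
  by apply: (central_root p_odd pch) => //; lia.
have [dE] := quartic_mem p_odd z4.
rewrite (fpt_1mod4 R pch (hom_homog 8 _)) ?dE ?size_quartic_ge //; last first.
  exact: (coprimep_quartic p_odd pch).
have := pow_in_quartic p_odd z 1; rewrite expn1 cz eqxx => ->.
by [].
Qed.

Lemma reduced_fpts_3mod4_sub (t : R) : (p = 3 %[mod 4])%N ->
  reduced_fpts R p k 8 t ->
  [\/ t = 1 / 4, (3 < p)%N /\ t = (p%:R - 3) / (4 * p%:R)
    | t = (p%:R ^+ 2 - 1) / (4 * p%:R ^+ 2)].
Proof.
move=> p3 /reduced_fptsP[f [hf sf sep <-]].
rewrite (fpt_3mod4 R pch) //; case: ifP => [T1|_].
  apply: Or32; split=> //; rewrite ltn_neqAle; apply/andP; split.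
    (* For [p = 3] the first truncation is the zeroth power, which is never in the ideal. *)
    by apply: contraTneq T1 => e3; rewrite -{1}e3; exact: (pow_in0 8 _ pch 1).
  by have := leq_mod p 4; rewrite p3.
by case: ifP => _; [apply: Or33|apply: Or31].
Qed.

Lemma reduced_fpts_char3 : p = 3%N -> reduced_fpts R p k 8 = [set 1 / 4; 2 / 9].
Proof.
move=> p3; have p3m : (p = 3 %[mod 4])%N by rewrite p3.
have p_odd : odd p by rewrite p3.
have val29 : (p%:R ^+ 2 - 1) / (4 * p%:R ^+ 2) = 2 / 9 :> R by rewrite p3; field.
apply/seteqP; split=> t /=.
  move=> /(reduced_fpts_3mod4_sub p3m); rewrite val29 => -[->|[]|->].
  - by left.
  - by rewrite p3.
  - by right.
case=> ->; first by apply: quarter_mem => //; right.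
have seven0 : 7%:R != 0 :> k by rewrite -(dvdn_pcharf pch) p3.
have [dE] := X8DX_mem seven0.
rewrite (fpt_3mod4 R pch (hom_homog 8 _)) ?dE ?size_X8DX //; last first.
  exact: coprimep_X8DX.
rewrite ifF; last by rewrite {1}p3; apply/negbTE; exact: (pow_in0 8 _ pch 1).
(* At [q = 9] and exponent 2 the range reduces to [i = 8], and the square of [X^8 + X] has no such
   term. *)
rewrite val29 ifT // p3; apply/pow_inP => i; rewrite /= => i9 i8.
have -> : i = 8%N by lia.
have -> : ('X^8 + 'X : {poly k}) ^+ (3 ^ 2 %/ 4) = 'X^16 + 'X^9 *+ 2 + 'X^2.
  by rewrite (_ : 3 ^ 2 %/ 4 = 2)%N //; ring.
by rewrite !coefD !coefXn /= !addr0.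
Qed.

Lemma reduced_fpts_3mod4 : (p = 3 %[mod 4])%N -> (3 < p)%N ->
  reduced_fpts R p k 8 =
    [set 1 / 4; (p%:R - 3) / (4 * p%:R);
         (p%:R ^+ 2 - 1) / (4 * p%:R ^+ 2)].
Proof.
move=> p3 gt3; have p_odd : odd p by rewrite -odd_mod4 p3.
pose m := (p %/ 4)%N; have pE : p = (4 * m + 3)%N.
  by rewrite {1}(divn_eq p 4) p3 mulnC.
have m0 : (0 < m)%N by lia.
apply/seteqP; split=> t /=.
  move=> /(reduced_fpts_3mod4_sub p3) [->|[_ ->]|->]; first by left; left.
    by left; right.
  by right.
case=> [[]|] ->; first by apply: quarter_mem => //; right.
  have [z z4 cz] : exists2 z : k, z ^+ 2 != 4 & (central k m).[z] = 0.
    by apply: (central_root p_odd pch) => //; lia.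
  have [dE] := quartic_mem p_odd z4.
  rewrite (fpt_3mod4 R pch (hom_homog 8 _)) ?dE ?size_quartic_ge //; last first.
    exact: (coprimep_quartic p_odd pch).
  by have := pow_in_quartic p_odd z 1; rewrite expn1 cz eqxx => ->.
have [t0 [z [sO sepO N0 m1]]] := exists_octic pch pE m0.
have [dE] := reduced_fpts_hom sO sepO.
rewrite (fpt_3mod4 R pch (hom_homog 8 _)) ?dE ?sO //.
rewrite ifF; last first.
  (* As [p = 4 m + 3], the exponent [4 m] lies in the range at level 1. *)
  apply/negbTE/pow_inPn; exists (4 * m)%N; rewrite -/m expn1; split=> //; lia.
have -> : (p ^ 2 %/ 4 = m * p + (3 * m + 2))%N.
  have -> : (p ^ 2 = (m * p + (3 * m + 2)) * 4 + 1)%N by rewrite pE; lia.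
  by rewrite divnMDl // addn0.
rewrite ifT //; apply/pow_inP => i iq di.
(* Since [p ^ 2] exceeds four times the exponent by 1, the middle index is the only one in the range
   at level 2. *)
suff -> : i = (4 * (m * p + (3 * m + 2)))%N by [].
have q2 : (p ^ 2 = 4 * (m * p + (3 * m + 2)) + 1)%N by rewrite pE; lia.
by rewrite q2 in iq di; lia.
Qed.

End Existence.

Theorem proposition7p9 (R : realType) (k : closedFieldType) (p : nat)
    (charkp : p \in [pchar k]) :
  [/\ p = 2%N ->
        reduced_fpts R p k 8 = [set 1 / 4],
      (p = 1 %[mod 4])%N ->
        reduced_fpts R p k 8 = [set 1 / 4; (p%:R - 1) / (4 * p%:R)],
      (p = 3 %[mod 4])%N -> (3 < p)%N ->
        reduced_fpts R p k 8 =
          [set 1 / 4; (p%:R - 3) / (4 * p%:R);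
               (p%:R ^+ 2 - 1) / (4 * p%:R ^+ 2)]
    & p = 3%N ->
        reduced_fpts R p k 8 = [set 1 / 4; 2 / 9]].
Proof.
split; [exact: reduced_fpts_char2|exact: reduced_fpts_1mod4| |].
  exact: reduced_fpts_3mod4.
exact: reduced_fpts_char3.
Qed.
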